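(* The map sending a finite-dimensional irreducible $\boxtimes_q$-module $V$ of type $1$ to the ordered pair of linear transformations of $V$ given by the actions of $x_{02}$ and $x_{13}$ induces a bijection between the following two sets: (i) the isomorphism classes of finite-dimensional irreducible $\boxtimes_q$-modules of type $1$; (ii) the isomorphism classes of $q$-inverting pairs over $\mathbb F$.
   Context: $\mathbb F$ is an algebraically closed field and $q\in\mathbb F$ is nonzero and not a root of $1$. $\mathbb Z_4=\mathbb Z/4\mathbb Z$, and $[n]_q=(q^n-q^{-n})/(q-q^{-1})$ for $n=0,1,2,\dots$. The $q$-tetrahedron algebra $\boxtimes_q$ is the unital associative $\mathbb F$-algebra with generators $\{x_{rs}\mid r,s\in\mathbb Z_4,\ s-r=1\text{ or }s-r=2\}$ and relations: (i) for $r,s\in\mathbb Z_4$ with $s-r=2$, $x_{rs}x_{sr}=1$; (ii) for $r,s,t\in\mathbb Z_4$ such that $(s-r,t-s)$ is one of $(1,1),(1,2),(2,1)$, $\dfrac{q x_{rs}x_{st}-q^{-1}x_{st}x_{rs}}{q-q^{-1}}=1$; (iii) for $r,s,t,u\in\mathbb Z_4$ with $s-r=t-s=u-t=1$, $x_{rs}^3x_{tu}-[3]_q x_{rs}^2x_{tu}x_{rs}+[3]_q x_{rs}x_{tu}x_{rs}^2-x_{tu}x_{rs}^3=0$. Known fact used to define type: for every finite-dimensional irreducible $\boxtimes_q$-module $V$ there exist an integer $d\ge 0$ and $\varepsilon\in\{1,-1\}$ such that every generator $x_{rs}$ acts semisimply on $V$ with set of eigenvalues $\{\varepsilon q^{d-2i}\mid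 0\le i\le d\}$. One calls $d$ the diameter and $\varepsilon$ the type of $V$. For a nonzero finite-dimensional $\mathbb F$-vector space $V$, a decomposition of $V$ is a sequence $\{V_i\}_{i=0}^d$ of nonzero subspaces with $V=\sum_{i=0}^d V_i$ (direct sum); set $V_{-1}=V_{d+1}=0$. A $q$-inverting pair on $V$ is an ordered pair of invertible linear transformations $K:V\to V$, $K^*:V\to V$ (here $K^*$ is just a name, not an adjoint of $K$) such that: (i) there is a decomposition $\{V_i\}_{i=0}^d$ of $V$ such that for $0\le i\le d$: $(K-q^{d-2i}I)V_i=0$, $K^*V_i\subseteq V_0+V_1+\cdots+V_{i+1}$, and $(K^* )^{-1}V_i\subseteq V_{i-1}+V_i+\cdots+V_d$; (ii) there is a decomposition $\{V_i^*\}_{i=0}^\delta$ of $V$ such that for $0\le i\le\delta$: $(K^*-q^{\delta-2i}I)V_i^*=0$, $KV_i^*\subseteq V_{i-1}^*+V_i^*+\cdots+V_\delta^*$, and $K^{-1}V_i^*\subseteq V_0^*+V_1^*+\cdots+V_{i+1}^*$ (with $V^*_{-1}=V^*_{\delta+1}=0$); (iii) there is no subspace $W\subseteq V$ with $KW\subseteq W$ and $K^*W\subseteq W$ other than $W=0$ and $W=V$. A $q$-inverting pair over $\mathbb F$ is a $q$-inverting pair on some $\mathbb F$-vector space of finite positive dimension, called the underlying vector space. An isomorphism of $q$-inverting pairs from $K,K^*$ (on $V$) to $K',K^{*\prime}$ (on $V'$) is a vector space isomorphism $\sigma:V\to V'$ with $\sigma K=K'\sigma$ and $\sigma K^*=K^{*\prime}\sigma$;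 two pairs are isomorphic if such a $\sigma$ exists. *)

(* Defs.v *)
From HB Require Import structures.
From mathcomp Require Import all_boot all_order all_algebra.
From mathcomp Require Import generic_quotient.
From mathcomp Require Import boolp.

Set Implicit Arguments.
Unset Strict Implicit.
Unset Printing Implicit Defensive.

Import GRing.Theory.
Local Open Scope quotient_scope.
Local Open Scope ring_scope.

(* Unital associative F-algebras given by generators X and relations rel:     *)
(* the algebra terms over X, modulo the least congruence that contains rel    *)
(* and the axioms of unital associative F-algebras.                           *)
Section Presentation.
Variables (F : fieldType) (X : Type).

Inductive term : Type :=
| Gen of X
| Cst of F
| Add of term & term
| Mul of term & term.

Variable rel : term -> term -> Prop.

Inductive cong : term -> term -> Prop :=
| cong_rel x y : rel x y -> cong x y
| cong_refl x : cong x x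
| cong_sym x y : cong x y -> cong y x
| cong_trans x y z : cong x y -> cong y z -> cong x z
| cong_Add x x' y y' : cong x x' -> cong y y' -> cong (Add x y) (Add x' y')
| cong_Mul x x' y y' : cong x x' -> cong y y' -> cong (Mul x y) (Mul x' y')
| cong_addA x y z : cong (Add x (Add y z)) (Add (Add x y) z)
| cong_addC x y : cong (Add x y) (Add y x)
| cong_add0 x : cong (Add (Cst 0) x) x
| cong_addN x : cong (Add (Mul (Cst (-1)) x) x) (Cst 0)
| cong_mulA x y z : cong (Mul x (Mul y z)) (Mul (Mul x y) z)
| cong_mul1l x : cong (Mul (Cst 1) x) x
| cong_mul1r x : cong (Mul x (Cst 1)) x
| cong_mulDl x y z : cong (Mul (Add x y) z) (Add (Mul x z) (Mul y z))
| cong_mulDr x y z : cong (Mul x (Add y z)) (Add (Mul x y) (Mul x z))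
| cong_CstD a b : cong (Cst (a + b)) (Add (Cst a) (Cst b))
| cong_CstM a b : cong (Cst (a * b)) (Mul (Cst a) (Cst b))
| cong_CstC a x : cong (Mul (Cst a) x) (Mul x (Cst a)).

HB.instance Definition _ := gen_eqMixin term.
HB.instance Definition _ := gen_choiceMixin term.

Definition congb (x y : term) : bool := `[< cong x y >].

Lemma congb_equiv : equiv_class_of congb.
Proof.
split=> [x|x y|y x z].
- exact/asboolP/cong_refl.
- by apply/asboolP/asboolP; apply: cong_sym.
- by move=> /asboolP xy /asboolP yz; apply/asboolP/(cong_trans xy).
Qed.

Canonical congb_rel : equiv_rel term := EquivRelPack congb_equiv.

Definition presAlg : Type := {eq_quot congb_rel}%qT.
HB.instance Definition _ := Choice.on presAlg.
HB.instance Definition _ := EqQuotient.on presAlg.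

Definition pa_of (t : term) : presAlg := \pi_presAlg t.

Lemma pa_eqP x y : pa_of x = pa_of y <-> cong x y.
Proof.
by split=> [/eqquotP/asboolP|xy] //; apply/eqquotP/asboolP.
Qed.

Lemma pa_ofK (a : presAlg) : pa_of (repr a) = a.
Proof. exact: reprK. Qed.

Lemma pa_reprK x : cong (repr (pa_of x)) x.
Proof. exact/pa_eqP/pa_ofK. Qed.

Definition pa_add (a b : presAlg) := pa_of (Add (repr a) (repr b)).
Definition pa_mul (a b : presAlg) := pa_of (Mul (repr a) (repr b)).
Definition pa_scale (c : F) (a : presAlg) := pa_of (Mul (Cst c) (repr a)).
Definition pa_opp (a : presAlg) := pa_scale (-1) a.

Lemma pa_of_Add x y : pa_add (pa_of x) (pa_of y) = pa_of (Add x y).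
Proof. exact/pa_eqP/cong_Add/pa_reprK/pa_reprK. Qed.

Lemma pa_of_Mul x y : pa_mul (pa_of x) (pa_of y) = pa_of (Mul x y).
Proof. exact/pa_eqP/cong_Mul/pa_reprK/pa_reprK. Qed.

Lemma pa_of_scale c x : pa_scale c (pa_of x) = pa_of (Mul (Cst c) x).
Proof. exact/pa_eqP/cong_Mul/pa_reprK/cong_refl. Qed.

Fact pa_addA : associative pa_add.
Proof.
move=> a b c; rewrite -[a]pa_ofK -[b]pa_ofK -[c]pa_ofK !pa_of_Add.
exact/pa_eqP/cong_addA.
Qed.

Fact pa_addC : commutative pa_add.
Proof.
move=> a b; rewrite -[a]pa_ofK -[b]pa_ofK !pa_of_Add.
exact/pa_eqP/cong_addC.
Qed.

Fact pa_add0 : left_id (pa_of (Cst 0)) pa_add.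
Proof. move=> a; rewrite -[a]pa_ofK pa_of_Add; exact/pa_eqP/cong_add0. Qed.

Fact pa_addN : left_inverse (pa_of (Cst 0)) pa_opp pa_add.
Proof.
move=> a; rewrite -[a]pa_ofK /pa_opp pa_of_scale pa_of_Add.
exact/pa_eqP/cong_addN.
Qed.

HB.instance Definition _ :=
  GRing.isZmodule.Build presAlg pa_addA pa_addC pa_add0 pa_addN.

Lemma pa_ofD x y : pa_of (Add x y) = pa_of x + pa_of y.
Proof. by rewrite -pa_of_Add. Qed.

Fact pa_mulA : associative pa_mul.
Proof.
move=> a b c; rewrite -[a]pa_ofK -[b]pa_ofK -[c]pa_ofK !pa_of_Mul.
exact/pa_eqP/cong_mulA.
Qed.

Fact pa_mul1l : left_id (pa_of (Cst 1)) pa_mul.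
Proof. move=> a; rewrite -[a]pa_ofK pa_of_Mul; exact/pa_eqP/cong_mul1l. Qed.

Fact pa_mul1r : right_id (pa_of (Cst 1)) pa_mul.
Proof. move=> a; rewrite -[a]pa_ofK pa_of_Mul; exact/pa_eqP/cong_mul1r. Qed.

Fact pa_mulDl : left_distributive pa_mul pa_add.
Proof.
move=> a b c; rewrite -[a]pa_ofK -[b]pa_ofK -[c]pa_ofK.
rewrite !(pa_of_Add, pa_of_Mul); exact/pa_eqP/cong_mulDl.
Qed.

Fact pa_mulDr : right_distributive pa_mul pa_add.
Proof.
move=> a b c; rewrite -[a]pa_ofK -[b]pa_ofK -[c]pa_ofK.
rewrite !(pa_of_Add, pa_of_Mul); exact/pa_eqP/cong_mulDr.
Qed.

HB.instance Definition _ :=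
  GRing.Zmodule_isPzRing.Build presAlg pa_mulA pa_mul1l pa_mul1r
    pa_mulDl pa_mulDr.

Fact pa_scaleA c d a : pa_scale c (pa_scale d a) = pa_scale (c * d) a.
Proof.
rewrite -[a]pa_ofK !pa_of_scale; apply/pa_eqP.
apply: cong_trans (cong_mulA _ _ _) _.
exact/cong_Mul/cong_refl/cong_sym/cong_CstM.
Qed.

Fact pa_scale1 : left_id 1 pa_scale.
Proof. move=> a; rewrite -[a]pa_ofK pa_of_scale; exact/pa_eqP/cong_mul1l. Qed.

Fact pa_scaleDr : right_distributive pa_scale +%R.
Proof.
move=> c a b; rewrite -[a]pa_ofK -[b]pa_ofK -pa_ofD !pa_of_scale -pa_ofD; exact/pa_eqP/cong_mulDr.
Qed.

Fact pa_scaleDl a : {morph pa_scale^~ a : c d / c + d}.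
Proof.
move=> c d; rewrite -[a]pa_ofK !pa_of_scale -pa_ofD; apply/pa_eqP.
apply: cong_trans _ (cong_mulDl _ _ _).
exact/cong_Mul/cong_refl/cong_CstD.
Qed.

Lemma pa_ofM x y : pa_of (Mul x y) = pa_of x * pa_of y.
Proof. by rewrite -pa_of_Mul. Qed.

HB.instance Definition _ :=
  GRing.Zmodule_isLmodule.Build F presAlg pa_scaleA pa_scale1
    pa_scaleDr pa_scaleDl.

Lemma pa_ofZ c x : pa_of (Mul (Cst c) x) = c *: pa_of x.
Proof. by rewrite -pa_of_scale. Qed.

(* presAlg may be the zero ring, so it has a pzRingType and an lmodType F     *)
(* structure, but not the library's algType F structure; the next two facts   *)
(* are the missing algebra axioms.                                            *)
Lemma presAlg_scaleAl (c : F) (a b : presAlg) : c *: (a * b) = (c *: a) * b.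
Proof.
rewrite -[a]pa_ofK -[b]pa_ofK.
rewrite -pa_ofM -!pa_ofZ -pa_ofM; exact/pa_eqP/cong_mulA.
Qed.

Lemma presAlg_scaleAr (c : F) (a b : presAlg) : c *: (a * b) = a * (c *: b).
Proof.
rewrite -[a]pa_ofK -[b]pa_ofK.
rewrite -pa_ofM -!pa_ofZ -pa_ofM.
apply/pa_eqP; apply: cong_trans (cong_mulA _ _ _) _.
apply: cong_trans _ (cong_sym (cong_mulA _ _ _)).
exact/cong_Mul/cong_refl/cong_CstC.
Qed.

Definition pa_gen (g : X) : presAlg := pa_of (Gen g).

End Presentation.

Section QTetrahedron.
Variables (F : fieldType) (q : F).

Definition qint (n : nat) : F := (q ^+ n - q ^- n) / (q - q^-1).

Definition adj (r s : 'Z_4) : bool := (s - r == 1) || (s - r == 2).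
Definition box_index : Type := {rs : 'Z_4 * 'Z_4 | adj rs.1 rs.2}.

Definition box_term : Type := term F box_index.

Definition tX (r s : 'Z_4) (h : adj r s) : box_term :=
  Gen F (exist (fun rs => adj rs.1 rs.2) (r, s) h).
Definition tpow (x : box_term) (n : nat) : box_term := iter n (Mul x) (Cst _ 1).
Definition tsub (x y : box_term) : box_term := Add x (Mul (Cst _ (-1)) y).

Local Notation "''C' a" := (Cst box_index a) (at level 8, a at level 2).
Local Notation "x ** y" := (Mul x y) (at level 40, left associativity).
Local Notation "x ++ y" := (Add x y).
Local Notation "x -- y" := (tsub x y) (at level 50, left associativity).
Local Notation "x *^ n" := (tpow x n) (at level 30).

Inductive box_rel : box_term -> box_term -> Prop :=
| box_rel_inv (r s : 'Z_4) (rs : adj r s) (sr : adj s r) :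
    s - r = 2 ->
    box_rel (tX rs ** tX sr) ('C 1)
| box_rel_weyl (r s t : 'Z_4) (rs : adj r s) (st : adj s t) :
    (s - r, t - s) \in [:: (1, 1); (1, 2); (2, 1)] ->
    box_rel
      ('C (q - q^-1)^-1 **
         ('C q ** tX rs ** tX st -- 'C q^-1 ** tX st ** tX rs))
      ('C 1)
| box_rel_serre (r s t u : 'Z_4) (rs : adj r s) (tu : adj t u) :
    s - r = 1 -> t - s = 1 -> u - t = 1 ->
    box_rel
      ((tX rs *^ 3 ** tX tu
        -- 'C (qint 3) ** tX rs *^ 2 ** tX tu ** tX rs)
       ++ ('C (qint 3) ** tX rs ** tX tu ** tX rs *^ 2
           -- tX tu ** tX rs *^ 3))
      ('C 0).

Definition boxq : Type := presAlg box_rel.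
HB.instance Definition _ := GRing.PzRing.on boxq.
HB.instance Definition _ := GRing.Lmodule.on boxq.

Definition xgen (g : box_index) : boxq := pa_gen box_rel g.
Definition x02 : boxq := xgen (exist _ (0, 2) isT).
Definition x13 : boxq := xgen (exist _ (1, 3) isT).

(* A finite-dimensional module over boxq is a finite-dimensional F-space with *)
(* a unital F-algebra morphism from boxq to its endomorphisms. The product of *)
(* 'End(V) is written out as composition because the library makes 'End(V) a  *)
(* ring only for V nonzero.                                                   *)
Record fdmod : Type := FdMod {
  fdmod_space :> vectType F;
  act : {linear boxq -> 'End(fdmod_space)};
  act1 : act 1 = \1%VF;
  actM : forall a b : boxq, act (a * b) = (act a \o act b)%VF
}.

Definition fdmod_iso (M N : fdmod) : Prop :=
  exists sigma : 'Hom(M, N), bijective sigma /\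
    forall (a : boxq) (v : M), sigma (act M a v) = act N a (sigma v).

Definition irreducible (M : fdmod) : Prop :=
  (fullv : {vspace M}) != 0%VS /\
  forall W : {vspace M}, (forall a : boxq, (act M a @: W <= W)%VS) ->
    W = 0%VS \/ W = fullv.

Definition semisimple (V : vectType F) (f : 'End(V)) : Prop :=
  forall U : {vspace V}, (f @: U <= U)%VS ->
    exists W : {vspace V},
      [/\ (f @: W <= W)%VS, (U + W)%VS = fullv & (U :&: W)%VS = 0%VS].

Definition has_type (e : F) (M : fdmod) : Prop :=
  exists d : nat, forall g : box_index,
    semisimple (act M (xgen g)) /\
    forall a : F, passmx.leigenvalue (act M (xgen g)) a <->
      exists2 i : nat, (i <= d)%N & a = e * q ^ (d%:Z - (2 * i)%:Z).

Definition irr_type1 (M : fdmod) : Prop := irreducible M /\ has_type 1 M.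

Definition decomposition (V : vectType F) (d : nat)
    (U : 'I_d.+1 -> {vspace V}) : Prop :=
  [/\ forall i, U i != 0%VS,
      directv (\sum_(i < d.+1) U i)
    & (\sum_(i < d.+1) U i)%VS = fullv].

(* An ordered pair of linear transformations of a finite-dimensional space.   *)
Record lpair : Type := LPair {
  lpair_space :> vectType F;
  opK : 'End(lpair_space);
  opKs : 'End(lpair_space)
}.

(* V_0 + ... + V_{i+1} is the sum over j <= i + 1, and V_{i-1} + ... + V_d    *)
(* the sum over j with i <= j + 1; an index outside 0..d contributes nothing. *)
Definition q_inverting (P : lpair) : Prop :=
  let K := opK P in let Ks := opKs P in
  [/\ (fullv : {vspace P}) != 0%VS,
      bijective K /\ bijective Ks,
      exists (d : nat) (U : 'I_d.+1 -> {vspace P}),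
        decomposition U /\
        forall i : 'I_d.+1,
          [/\ ((K - q ^ (d%:Z - (2 * i)%:Z) *: \1) @: U i = 0)%VS,
              (Ks @: U i <= \sum_(j < d.+1 | (j <= i.+1)%N) U j)%VS
            & (Ks^-1 @: U i <= \sum_(j < d.+1 | (i <= j.+1)%N) U j)%VS],
      exists (delta : nat) (U : 'I_delta.+1 -> {vspace P}),
        decomposition U /\
        forall i : 'I_delta.+1,
          [/\ ((Ks - q ^ (delta%:Z - (2 * i)%:Z) *: \1) @: U i = 0)%VS,
              (K @: U i <= \sum_(j < delta.+1 | (i <= j.+1)%N) U j)%VS
            & (K^-1 @: U i <= \sum_(j < delta.+1 | (j <= i.+1)%N) U j)%VS]
    & forall W : {vspace P}, (K @: W <= W)%VS -> (Ks @: W <= W)%VS ->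
        W = 0%VS \/ W = fullv].

Definition lpair_iso (P Q : lpair) : Prop :=
  exists sigma : 'Hom(P, Q), [/\ bijective sigma,
    (sigma \o opK P)%VF = (opK Q \o sigma)%VF
    & (sigma \o opKs P)%VF = (opKs Q \o sigma)%VF].

Definition lpair_of (M : fdmod) : lpair := LPair (act M x02) (act M x13).

End QTetrahedron.

(* Classes are predicates T -> Prop rather than the library's set T, whose    *)
(* universe is too small to contain types such as fdmod and lpair.            *)
Definition iso_class (T : Type) (P : T -> Prop) (iso : T -> T -> Prop) (x : T) :
  T -> Prop := fun y => P y /\ iso x y.

Definition is_iso_class (T : Type) (P : T -> Prop) (iso : T -> T -> Prop)
  (C : T -> Prop) : Prop := exists2 x, P x & C = iso_class P iso x.

Definition bijective_on (A B : Type) (a : A -> Prop) (b : B -> Prop)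
    (f : A -> B) : Prop :=
  [/\ forall x, a x -> b (f x),
      forall x y, a x -> a y -> f x = f y -> x = y
    & forall y, b y -> exists2 x, a x & f x = y].

(* A map f from the objects satisfying P to the objects satisfying Q induces  *)
(* a bijection between their isomorphism classes.                             *)
Definition induces_bijection (S T : Type)
    (P : S -> Prop) (isoS : S -> S -> Prop)
    (Q : T -> Prop) (isoT : T -> T -> Prop) (f : S -> T) : Prop :=
  (forall x, P x -> Q (f x)) /\
  exists Phi : (S -> Prop) -> (T -> Prop),
    (forall x, P x -> Phi (iso_class P isoS x) = iso_class Q isoT (f x)) /\
    bijective_on (is_iso_class P isoS) (is_iso_class Q isoT) Phi.

(* Main.v *)
From HB Require Import structures.
Require Import Defs.
From mathcomp Require Import all_boot all_order all_algebra.
From mathcomp Require Import ring zify.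
Set Implicit Arguments.
Unset Strict Implicit.
Unset Printing Implicit Defensive.
Import GRing.Theory.
Local Open Scope ring_scope.

(** Write z_r = x_{r,r+2} and y_r = x_{r,r+1} for r in Z/4. The pair attached
    to a module is (z_0, z_1), and z_2, z_3 are the inverses of z_0, z_1; the
    point is to recover the four y_r from z_0 and z_1. The tool is a family of
    four flags: H_r i is the sum of the eigenspaces of z_r for the first i of
    the eigenvalues q^d, q^(d-2), ..., q^-d. Everything is invariant under
    r -> r + 1, so each statement is made for all r at once.

    Modules give pairs. If q x y - q^-1 y x = q - q^-1 and v is an eigenvector
    of one of x, y for t, then the other one sends v to v / t plus an
    eigenvector for q^2 t or q^-2 t ([weyl_at_eigr], [weyl_at_eigl]). So y_r is
    triangular on H_r and on H_(r+1), and its eigenspaces, added up from the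
    top or from the bottom eigenvalue, give back H_r and H_(r+1) ([qflag_y],
    [qflagV_y]). Consequently z_(r+1) raises H_r by one step ([raises_z]), and
    the four instances of this are the conditions defining a q-inverting pair
    ([adaptedP]).

    Irreducibility of the pair. For a subspace W stable under all z_s, the sum
    over i of W meet H_r i meet H_(r+1) (m - i) is again stable
    ([meets_zstable]). When W is minimal this sum is 0 or W; the positions of
    the first and the last nonzero components of W force it to be W for
    m = d + 2, where y_r acts on each term by a scalar, so W is a submodule
    ([y_stable_of_minimal]).

    Pairs give modules. For W = V the same sum is 0 or V. Comparing values of m
    shows that the two diameters agree ([diameter_const]) and that V is the
    direct sum of the spaces H_r (i+1) meet H_(r+1) (d+1-i). Let y_r be
    q^(d-2i) on the i-th of them ([reconstruction]). The relations between y_r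
    and the z_s hold piece by piece; those among the y_r follow since the other
    operators move each flag by at most one step ([weyl_yy], [serre_yy]).

    Isomorphic pairs come from isomorphic modules. If s intertwines z_0 and z_1,
    then D = s y_r - y_r s multiplies eigenvalues of z_(r+1) by q^2. Its kernel
    is stable under the z_s, so D is zero or injective; an injective D would
    create the eigenvalue q^(d+2) ([intertwiner_extends]). *)

(** * Eigenspaces, flags and triangular operators *)

Notation eig := passmx.leigenspace.

Section Coordinates.
Variables (F : fieldType) (V W : vectType F) (f : 'Hom(V, W)).
Implicit Types (u v : V) (a : F).

(** Coordinates in a fixed basis turn an identity between vectors into one
    between scalars, where ring and field apply. *)
Definition coord_at v i := coord (vbasis (fullv : {vspace V})) i v.

Lemma eq_coord_at u v : coord_at u =1 coord_at v -> u = v.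
Proof.
move=> uv; rewrite (coord_vbasis (memvf u)) (coord_vbasis (memvf v)).
by apply: eq_bigr => i _; congr (_ *: _); apply: uv.
Qed.

Lemma coordE :
  (forall u v i, coord_at (u + v) i = coord_at u i + coord_at v i) *
  (forall v i, coord_at (- v) i = - coord_at v i) *
  (forall a v i, coord_at (a *: v) i = a * coord_at v i) *
  (forall i, coord_at 0 i = 0).
Proof.
by split; [split; [split|]|] => *;
  rewrite /coord_at ?(linearD, linearN, linearZ, linear0).
Qed.

Lemma homE :
  (forall u v, f (u + v) = f u + f v) * (forall v, f (- v) = - f v) *
  (forall a v, f (a *: v) = a *: f v) * (f 0 = 0).
Proof.
by split; [split; [split|]|] => *; rewrite ?(linearD, linearN, linearZ, linear0).
Qed.

End Coordinates.

Ltac coords := rewrite ?homE; apply: eq_coord_at => ?; rewrite ?coordE.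

Section Eigen.
Variables (F : fieldType) (V : vectType F).
Implicit Types (f g : 'End(V)) (U W : {vspace V}) (v w : V) (E : nat -> {vspace V}).

Lemma eigP f a v : reflect (f v = a *: v) (v \in eig f a).
Proof.
rewrite memv_ker add_lfunE opp_lfunE scale_lfunE id_lfunE subr_eq0; exact: eqP.
Qed.

Lemma eig_inverse f g a : cancel g f -> cancel f g -> a != 0 ->
  eig g a^-1 = eig f a.
Proof.
move=> fg gf a0; apply/vspaceP => v; apply/eigP/eigP => Ev.
  by rewrite -{2}(fg v) Ev linearZ /= scalerA divff // scale1r.
by rewrite -{2}(gf v) Ev linearZ /= scalerA mulVf // scale1r.
Qed.

Definition flag E n : {vspace V} := (\sum_(j < n) E j)%VS.

Lemma flag0 E : flag E 0 = 0%VS.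
Proof. by rewrite /flag big_ord0. Qed.

Lemma mem_flag0 E v : v \in flag E 0 -> v = 0.
Proof. by rewrite flag0 memv0 => /eqP. Qed.

Lemma flagS E n : flag E n.+1 = (flag E n + E n)%VS.
Proof. by rewrite /flag big_ord_recr. Qed.

Lemma flag_mono E m n : (m <= n)%N -> (flag E m <= flag E n)%VS.
Proof.
elim: n => [|n IH]; first by rewrite leqn0 => /eqP->.
rewrite leq_eqVlt => /predU1P[-> //|/IH le]; rewrite flagS.
exact: subv_trans le (addvSl _ _).
Qed.

Lemma mem_flag E i n v : (i < n)%N -> v \in E i -> v \in flag E n.
Proof.
move=> lt vE; apply: (subvP (flag_mono E lt)); rewrite flagS.
exact: (subvP (addvSr _ _)).
Qed.

(** On the chain N the operator g acts with diagonal entries a 0, a 1, ... *)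
Definition triangular g (a : nat -> F) (N : nat -> {vspace V}) :=
  forall i v, v \in N i.+1 -> g v - a i *: v \in N i.

Definition raises g (N : nat -> {vspace V}) :=
  forall i v, v \in N i -> g v \in N i.+1.

Lemma mem_flagP E n v : v \in flag E n ->
  exists2 u : nat -> V, (forall i, (i < n)%N -> u i \in E i) & v = \sum_(i < n) u i.
Proof.
case/memv_sumP=> u uE ->; exists (fun i => oapp u 0 (insub i)).
  by move=> i lt; rewrite (insubT (fun i => i < n)%N lt) /=; apply: uE.
by apply: eq_bigr => i _; rewrite valK.
Qed.

Lemma flag_stable g E n (N : {vspace V}) :
  (forall i v, (i < n)%N -> v \in E i -> g v \in N) ->
  forall v, v \in flag E n -> g v \in N.
Proof.
move=> gE v /memv_sumP[u uE ->]; rewrite linear_sum memv_suml // => i _.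
exact: gE (ltn_ord i) (uE i isT).
Qed.

Lemma flag_triangular g a E :
  (forall i v, v \in E i -> g v - a i *: v \in flag E i) -> triangular g a (flag E).
Proof.
move=> gE i v; rewrite flagS => /memv_addP[u uN [w wE ->]].
have gN : forall x, x \in flag E i -> g x \in flag E i.
  apply: flag_stable => j x lt xE; rewrite -(subrK (a j *: x) (g x)) memvD //.
    exact: (subvP (flag_mono E (ltnW lt))) (gE _ _ xE).
  by rewrite memvZ // (mem_flag lt).
rewrite linearD scalerDr opprD addrACA; apply: memvD (gE _ _ wE).
by apply: memvB (gN _ uN) _; exact: memvZ.
Qed.

Lemma triangular_stable g a E : triangular g a (flag E) ->
  forall i v, v \in flag E i -> g v \in flag E i.
Proof.
move=> triE [|i] v vE.
  by rewrite (mem_flag0 vE) linear0 mem0v.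
rewrite -(subrK (a i *: v) (g v)) memvD ?memvZ //.
exact: (subvP (flag_mono E (leqnSn i))) (triE _ _ vE).
Qed.

Lemma flag_raises g E :
  (forall i v, v \in E i -> exists a, g v - a *: v \in E i.+1) ->
  raises g (flag E).
Proof.
move=> gE i; apply: flag_stable => j v lt vE; have [a gv] := gE _ _ vE.
rewrite -(subrK (a *: v) (g v)) memvD ?(mem_flag _ gv) //.
by rewrite memvZ // (mem_flag _ vE) // ltnS ltnW.
Qed.

(** Subtracting sum_j (a j - a i)^-1 u_j from v, where g v - a i v = sum_j u_j,
    turns a vector of the next step into an eigenvector. *)
Lemma triangular_flag_eig g a (N : nat -> {vspace V}) : injective a ->
  N 0 = 0%VS -> triangular g a N ->
  forall i, (N i <= flag (fun j => eig g (a j)) i)%VS.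
Proof.
move=> a_inj N0 triN; elim=> [|i IH]; first by rewrite N0 sub0v.
apply/subvP => v /triN /(subvP IH) /memv_sumP[u uE Ev].
pose u' := \sum_(j < i) (a j - a i)^-1 *: u j.
have u'N : u' \in flag (fun j => eig g (a j)) i.
  by apply: memv_suml => j _; rewrite memvZ // (mem_flag (ltn_ord j)) ?uE.
rewrite -(subrK u' v) flagS addrC memv_add //; apply/eigP.
suff Eu : g u' - a i *: u' = \sum_(j < i) u j.
  by rewrite ?homE -[g v](subrK (a i *: v)) Ev -Eu; coords; ring.
rewrite /u' linear_sum scaler_sumr -sumrB /=; apply: eq_bigr => j _.
have /eigP gu := uE j isT; rewrite linearZ /= gu.
have ne : a j - a i != 0.
  rewrite subr_eq0; apply/eqP => /a_inj Eji.
  by have := ltn_ord j; rewrite Eji ltnn.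
by coords; field.
Qed.


Lemma memvZ_cancel a v U : a != 0 -> a *: v \in U -> v \in U.
Proof. by move=> a0 avU; rewrite -(scalerK a0 v) memvZ. Qed.

(** A common vector of M i and E j is an eigenvector for a (i-1), by induction
    on i; no such eigenvalue occurs on the diagonal of E below j, so the vector
    descends to E 0. *)
Lemma triangular_disjoint g a b (M E : nat -> {vspace V}) d :
    M 0 = 0%VS -> triangular g a M -> triangular g b (flag E) ->
    (forall i j, (i + j).+1 < d -> a i != b j)%N ->
  forall i j v, (i + j <= d)%N -> v \in M i -> v \in flag E j -> v = 0.
Proof.
move=> M0 triM triE neq; elim=> [|i IHi] j v lij vM vE.
  by apply/eqP; rewrite -memv0 -M0.
have /eqP : g v - a i *: v = 0.
  apply: (IHi j) (triM _ _ vM) _; first by rewrite ltnW.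
  case: j vE {lij} => [|j] vE.
    by rewrite (mem_flag0 vE) !homE scaler0 subrr mem0v.
  have -> : g v - a i *: v = (g v - b j *: v) + (b j - a i) *: v.
    by coords; ring.
  by rewrite memvD ?memvZ //; apply: subvP (flag_mono E (leqnSn j)) _ (triE _ _ vE).
rewrite subr_eq0 => /eqP gv.
elim: j => [|j IHj] in lij vE *; first by apply/eqP; rewrite -memv0 -(flag0 E).
apply: IHj; first by lia.
have ne : a i - b j != 0 by rewrite subr_eq0 neq //; lia.
by apply: (memvZ_cancel ne); rewrite scalerBl -gv triE.
Qed.

(** The eigencomponents of a vector of a stable subspace stay in it: apply
    f - c n to eliminate the last component and induct. *)
Lemma sum_eig_mem f (n : nat) (c : nat -> F) (u : nat -> V) U :
    (forall i j, (i < n)%N -> (j < n)%N -> c i = c j -> i = j) ->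
    (forall i, (i < n)%N -> u i \in eig f (c i)) ->
    (forall v, v \in U -> f v \in U) ->
  \sum_(i < n) u i \in U -> forall i, (i < n)%N -> u i \in U.
Proof.
move=> c_inj uE fU; elim: n u c_inj uE => // n IH u c_inj uE sumU.
have lastU : forall i, (i < n)%N -> u i \in U.
  move=> i lt; have ne: c i - c n != 0.
    rewrite subr_eq0; apply/eqP => /c_inj Ein.
    by have := Ein (ltnW lt) (ltnSn n) => E; rewrite E ltnn in lt.
  apply: (memvZ_cancel ne).
  apply: (IH (fun i => (c i - c n) *: u i)) lt => [k l lk ll|k lk|].
  - by apply: c_inj; apply: ltnW.
  - by rewrite memvZ // uE // ltnW.
  have /eigP fun_ : u n \in eig f (c n) by apply: uE.
  suff -> : \sum_(k < n) (c k - c n) *: u k =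
     f (\sum_(k < n.+1) u k) - c n *: \sum_(k < n.+1) u k.
    by apply: memvB (fU _ sumU) _; exact: memvZ.
  rewrite big_ord_recr /= linearD scalerDr opprD addrACA /= fun_ subrr addr0.
  rewrite linear_sum scaler_sumr -sumrB; apply: eq_bigr => k _ /=.
  have /eigP-> : u k \in eig f (c k) by apply: uE; rewrite ltnS ltnW.
  by rewrite scalerBl.
move=> i; rewrite ltnS leq_eqVlt => /predU1P[->|/lastU //].
have sumnU : \sum_(k < n) u k \in U by apply: memv_suml => k _; apply: lastU.
by move: sumU; rewrite big_ord_recr /= (rpredDl _ sumnU).
Qed.

(** The hypothesis makes E 0, ..., E (n-1) independent; the operator is built
    from the projections, one summand at a time. *)
Lemma exists_scaling_op E (c : nat -> F) n :
    (forall k, (k < n)%N -> (flag E k :&: E k)%VS = 0%VS) ->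
  exists g : 'End(V), forall i v, (i < n)%N -> v \in E i -> g v = c i *: v.
Proof.
elim: n => [|n IH] disj; first by exists 0.
have [|g gE] := IH; first by move=> k lt; apply: disj; apply: ltnW.
have dj := disj n (ltnSn n); have dj' := dj; rewrite capvC in dj'.
pose p := daddv_pi (flag E n) (E n); pose p' := daddv_pi (E n) (flag E n).
exists ((g \o p)%VF + c n *: p') => i v; rewrite ltnS leq_eqVlt.
rewrite add_lfunE scale_lfunE comp_lfunE => /predU1P[->|lt] vE.
  have := daddv_pi_add dj (subvP (addvSr _ _) _ vE).
  rewrite /p /p' (daddv_pi_id dj' vE) => /eqP; rewrite -subr_eq0 addrK => /eqP->.
  by rewrite linear0 add0r.
have vF := mem_flag lt vE; have := daddv_pi_add dj (subvP (addvSl _ _) _ vF).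
rewrite /p /p' (daddv_pi_id dj vF) => /eqP; rewrite -subr_eq0 addrAC subrr add0r.
by move/eqP->; rewrite scaler0 addr0 (gE i).
Qed.

(** For two flags this is the antidiagonal on which a split decomposition lives. *)
Definition meets W (M N : nat -> {vspace V}) m : {vspace V} :=
  (\sum_(i < m.+1) (W :&: (M i :&: N (m - i)%N)))%VS.

Lemma mem_meets W (M N : nat -> {vspace V}) m i j v : (i + j = m)%N ->
  v \in W -> v \in M i -> v \in N j -> v \in meets W M N m.
Proof.
move=> ijm vW vM vN; have lti : (i < m.+1)%N by lia.
apply: (subvP (sumv_sup (Ordinal lti) _ (subvv _))) => //=.
by rewrite !memv_cap vW vM (_ : (m - i)%N = j) //; lia.
Qed.

Lemma meets_ind W (M N : nat -> {vspace V}) m (f : 'End(V)) U :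
  (forall i j v, (i + j = m)%N -> v \in W -> v \in M i -> v \in N j ->
     f v \in U) ->
  forall v, v \in meets W M N m -> f v \in U.
Proof.
move=> fU v /memv_sumP[u uE ->]; rewrite linear_sum; apply: memv_suml => i _ /=.
have := uE i isT; rewrite !memv_cap => /and3P[uW uM uN].
by apply: (fU i (m - i)%N) => //; have := ltn_ord i; lia.
Qed.

(** On M i meet N j with i + j = m the operator is a scalar plus a map into
    M (i-1) meet N (j+1), which lies on the same antidiagonal. *)
Lemma meets_stable W g a (E N : nat -> {vspace V}) m :
    (forall v, v \in W -> g v \in W) ->
    triangular g a (flag E) -> (forall i j, (i <= j)%N -> (N i <= N j)%VS) -> raises g N ->
  forall v, v \in meets W (flag E) N m -> g v \in meets W (flag E) N m.
Proof.
move=> gW triE monoN shN; apply: meets_ind => -[|i] j v ijm vW vE vN.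
  by rewrite (mem_flag0 vE) linear0 mem0v.
rewrite -(subrK (a i *: v) (g v)); apply: memvD; last first.
  by rewrite memvZ //; apply: (mem_meets ijm).
apply: (@mem_meets _ _ _ _ i j.+1); first by lia.
- by apply: memvB; [apply: gW | apply: memvZ].
- exact: triE.
by apply: memvB; [apply: shN | apply/memvZ/(subvP (monoN _ _ (leqnSn j)))].
Qed.

Lemma meets_sub W (M N : nat -> {vspace V}) m U :
  (forall i j v, (i + j = m)%N -> v \in W -> v \in M i -> v \in N j -> v \in U) ->
  (meets W M N m <= U)%VS.
Proof.
move=> sub; apply/subvP => v; rewrite -{2}[v]id_lfunE; apply: meets_ind => i j u.
by rewrite id_lfunE; apply: sub.
Qed.

Lemma meetsC W (M N : nat -> {vspace V}) m : meets W M N m = meets W N M m.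
Proof.
suff le M' N' : (meets W M' N' m <= meets W N' M' m)%VS.
  by apply/eqP; rewrite eqEsubv !le.
apply: meets_sub => i j u ijm uW uM uN.
by apply: (@mem_meets _ _ _ _ j i) => //; rewrite addnC.
Qed.

End Eigen.

(** * Arithmetic modulo 4 *)

Lemma Z4_cases (r s : 'Z_4) : [\/ s = r, s = r + 1, s = r + 2 | s = r + 3].
Proof.
by case: r s => [[|[|[|[|]]]] ?] // [[|[|[|[|]]]] ?] //;
  do [constructor 1; exact: val_inj | constructor 2; exact: val_inj
     | constructor 3; exact: val_inj | constructor 4; exact: val_inj].
Qed.

Lemma Z4_add11 (r : 'Z_4) : r + 1 + 1 = r + 2.
Proof. by rewrite -addrA. Qed.

Lemma Z4_add22 (r : 'Z_4) : r + 2 + 2 = r.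
Proof. by rewrite -addrA [X in r + X](_ : _ = 0) ?addr0 //; apply: val_inj. Qed.

Lemma Z4_add32 (r : 'Z_4) : r + 3 + 2 = r + 1.
Proof. by rewrite -addrA; congr (r + _); apply: val_inj. Qed.

Lemma Z4_add21 (r : 'Z_4) : r + 2 + 1 = r + 3.
Proof. by rewrite -addrA; congr (r + _); apply: val_inj. Qed.

Lemma Z4_add12 (r : 'Z_4) : r + 1 + 2 = r + 3.
Proof. by rewrite -addrA; congr (r + _); apply: val_inj. Qed.

Lemma Z4_ind (P : 'Z_4 -> Prop) : P 0 -> P 1 -> P 2 -> P 3 -> forall r, P r.
Proof.
move=> P0 P1 P2 P3 [[|[|[|[|]]]] lt] //.
- by rewrite (_ : Ordinal lt = 0) //; apply: val_inj.
- by rewrite (_ : Ordinal lt = 1) //; apply: val_inj.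
- by rewrite (_ : Ordinal lt = 2) //; apply: val_inj.
by rewrite (_ : Ordinal lt = 3) //; apply: val_inj.
Qed.

Lemma Z4_addKl (r a : 'Z_4) : r + a - r = a.
Proof. by rewrite addrAC subrr add0r. Qed.

Lemma Z4_sub2 (r : 'Z_4) : r - (r + 2) = 2.
Proof. by move: r; apply: Z4_ind; apply: val_inj. Qed.

(** * Weyl pairs and the q-string of eigenvalues *)

Section Weyl.
Variables (F : fieldType) (q : F) (q_neq0 : q != 0).

Section Pair.
Variables (V : vectType F) (x y : 'End(V)).

(** The relation (q x y - q^-1 y x) / (q - q^-1) = 1, cleared of denominators
    and evaluated at a vector. *)
Definition weyl_at v := q *: x (y v) - q^-1 *: y (x v) = (q - q^-1) *: v.
Definition weyl := forall v, weyl_at v.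

(** On an eigenvector v of y, the Weyl relation determines y (x v), and this
    amounts to x v - v / t being an eigenvector for q^2 t. *)
Lemma weyl_at_eigr t v : t != 0 -> y v = t *: v ->
  weyl_at v <-> x v - t^-1 *: v \in eig y (q ^+ 2 * t).
Proof.
move=> t0 yv; rewrite /weyl_at yv homE; split=> [E|/eigP E].
  have yxv : y (x v) = q *: (q *: (t *: x v) - (q - q^-1) *: v).
    by rewrite -E; coords; field; rewrite ?q_neq0 ?t0.
  by apply/eigP; rewrite !homE yxv yv; coords; field; rewrite ?q_neq0 ?t0.
have -> : y (x v) = y (x v - t^-1 *: v) + v.
  by rewrite ?homE yv; coords; field; rewrite ?q_neq0 ?t0.
by rewrite E; coords; field; rewrite ?q_neq0 ?t0.
Qed.

Lemma weyl_at_eigl t v : t != 0 -> x v = t *: v ->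
  weyl_at v <-> y v - t^-1 *: v \in eig x (q ^- 2 * t).
Proof.
move=> t0 xv; rewrite /weyl_at xv homE; split=> [E|/eigP E].
  have xyv : x (y v) = q^-1 *: (q^-1 *: (t *: y v) + (q - q^-1) *: v).
    by rewrite -E; coords; field; rewrite ?q_neq0 ?t0.
  by apply/eigP; rewrite !homE xyv xv; coords; field; rewrite ?q_neq0 ?t0.
have -> : x (y v) = x (y v - t^-1 *: v) + v.
  by rewrite ?homE xv; coords; field; rewrite ?q_neq0 ?t0.
by rewrite E; coords; field; rewrite ?q_neq0 ?t0.
Qed.

End Pair.

Hypothesis q_not_root1 : forall n : nat, (0 < n)%N -> q ^+ n != 1.

Lemma expqz_inj : injective (fun m : int => q ^ m).
Proof.
move=> m n /= E; have {}E : q ^ (m - n) = 1.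
  by rewrite expfzDr // E -expfzDr // subrr expr0z.
apply/eqP; rewrite -subr_eq0; case: (m - n) E => [[//|k]|k] /eqP.
  by rewrite -exprnP (negPf (q_not_root1 _)).
by rewrite NegzE -exprnN invr_eq1 (negPf (q_not_root1 _)).
Qed.

Definition qev (d i : nat) : F := q ^ (d%:Z - (2 * i)%:Z).

Lemma qev_neq0 d i : qev d i != 0.
Proof. exact: expfz_neq0. Qed.

Lemma qev_inj d : injective (qev d).
Proof. by move=> i j /expqz_inj; lia. Qed.

Lemma qevS d i : qev d i.+1 = q ^- 2 * qev d i.
Proof. by rewrite -[q ^- 2]/(q ^ (-2%:Z)) -expfzDr //; congr (q ^ _); lia. Qed.

Lemma qevSK d i : q ^+ 2 * qev d i.+1 = qev d i.
Proof. by rewrite qevS mulVKf // expf_neq0. Qed.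

Lemma qevV d i j : (i + j = d)%N -> (qev d i)^-1 = qev d j.
Proof. by move=> ijd; rewrite /qev invr_expz; congr (q ^ _); lia. Qed.

Lemma qevV_neq d i j : (i + j != d)%N -> (qev d i)^-1 != qev d j.
Proof.
by rewrite /qev invr_expz; apply: contra => /eqP/expqz_inj E; lia.
Qed.

Lemma qev_above_neq d i : q ^+ 2 * qev d 0 != qev d i.
Proof.
rewrite -[q ^+ 2]/(q ^ 2%:Z) /qev -expfzDr //; apply/eqP => /expqz_inj; lia.
Qed.

Section Diagonal.
Variables (V : vectType F) (d : nat) (f : 'End(V)).

Definition qflag (f : 'End(V)) := flag (fun i => eig f (qev d i)).
(** The flag built from the opposite end of the q-string. *)
Definition qflagV (f : 'End(V)) := flag (fun i => eig f (qev d i)^-1).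
Definition qdiag (f : 'End(V)) := qflag f d.+1 = fullv.

Lemma qflag_triangular : triangular f (qev d) (qflag f).
Proof. by apply: flag_triangular => i w /eigP->; rewrite subrr mem0v. Qed.

Lemma qflag_eig0 a v n : (forall i, (i < n)%N -> a != qev d i) ->
  v \in eig f a -> v \in qflag f n -> v = 0.
Proof.
move=> neq /eigP fv; elim: n neq => [|n IH] neq.
  by rewrite /qflag flag0 memv0 => /eqP.
move=> /qflag_triangular; rewrite fv -scalerBl => vE; apply: IH => [i lt|].
  by apply: neq; rewrite ltnW.
by apply: memvZ_cancel vE; rewrite subr_eq0 neq.
Qed.

Hypothesis fdiag : qdiag f.

Lemma qdiag_eig0 a v : (forall i, (i <= d)%N -> a != qev d i) ->
  v \in eig f a -> v = 0.
Proof.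
move=> neq vE; apply: (@qflag_eig0 a v d.+1) => //.
by rewrite [qflag f _]fdiag memvf.
Qed.

Lemma qdiag_ind (P : V -> Prop) : P 0 -> (forall u v, P u -> P v -> P (u + v)) ->
  (forall i v, (i <= d)%N -> v \in eig f (qev d i) -> P v) -> forall v, P v.
Proof.
move=> P0 PD Pe v; have: v \in qflag f d.+1 by rewrite fdiag memvf.
case/memv_sumP=> u uE ->; elim/big_ind: _ => // i _.
by apply: (Pe i); rewrite ?uE // -ltnS.
Qed.


(** For i = 0 the eigenvalue q^(d+2) lies outside the spectrum, and otherwise it
    is the previous one of the q-string. *)
Lemma qdiag_above i v : v \in eig f (q ^+ 2 * qev d i) -> v \in qflag f i.
Proof.
case: i => [|i]; first by move/qdiag_eig0->; rewrite ?mem0v // => i _; exact: qev_above_neq.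
by rewrite qevSK => vE; apply: mem_flag vE.
Qed.

Lemma qdiag_aboveV i v : v \in eig f (q ^- 2 * (qev d i)^-1) -> v \in qflagV f i.
Proof.
rewrite -invfM; case: i => [|i].
  move/qdiag_eig0->; rewrite ?mem0v // => j lej.
  rewrite -[q ^+ 2]/(q ^ 2%:Z) /qev -expfzDr // invr_expz.
  by apply/eqP => /expqz_inj; lia.
by rewrite qevSK => vE; apply: mem_flag vE.
Qed.

End Diagonal.

(** * The four flags of a pair of invertible operators *)

Section Inverses.
Variables (V : vectType F) (z : 'Z_4 -> 'End(V)).
Hypothesis zz : forall r v, z r (z (r + 2) v) = v.

Lemma zzV r v : z (r + 2) (z r v) = v.
Proof. by rewrite -{2}(Z4_add22 r) zz. Qed.

Lemma eig_inv r a : a != 0 -> eig (z (r + 2)) a^-1 = eig (z r) a.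
Proof. by apply: eig_inverse => v; rewrite ?zz ?zzV. Qed.

Definition zstable (U : {vspace V}) := forall s v, v \in U -> z s v \in U.

(** In finite dimension an injective operator maps a stable subspace onto
    itself. *)
Lemma zstable_inv r (U : {vspace V}) :
  (forall v, v \in U -> z r v \in U) -> forall v, v \in U -> z (r + 2) v \in U.
Proof.
move=> zU v vU; have ker0 : lker (z r) == 0%VS.
  by apply/lker0P => a b E; rewrite -(zzV r a) E zzV.
have/eqP E : (z r @: U == U)%VS.
  rewrite eqEdim limg_dim_eq ?leqnn ?andbT ?(eqP ker0) ?capv0 //.
  by apply/subvP => _ /memv_imgP[w wU ->]; apply: zU.
by move: vU; rewrite -{1}E => /memv_imgP[w wU ->]; rewrite zzV.
Qed.

Lemma zstable2 r (U : {vspace V}) :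
    (forall v, v \in U -> z r v \in U) -> (forall v, v \in U -> z (r + 1) v \in U) ->
  zstable U.
Proof.
move=> U0 U1 s; have [->|->|->|->] := Z4_cases r s => //.
  exact: zstable_inv.
by rewrite -Z4_add12; apply: zstable_inv.
Qed.

Variable d : 'Z_4 -> nat.
Local Notation H r := (qflag (d r) (z r)).

Lemma triangular_zV r : triangular (z (r + 2)) (fun i => (qev (d r) i)^-1) (H r).
Proof.
apply: flag_triangular => i v; rewrite -eig_inv ?qev_neq0 // => /eigP->.
by rewrite subrr mem0v.
Qed.

Hypothesis raises_z : forall r, raises (z (r + 1)) (H r).

(** z_(r+2), the inverse of z_r, is triangular on H_r and raises H_(r+1);
    z_(r+1) is triangular on H_(r+1) and raises H_r. These two and their
    inverses are all four operators. *)
Lemma meets_zstable W r m : zstable W ->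
  zstable (meets W (H r) (H (r + 1)) m).
Proof.
move=> zW; apply: (@zstable2 (r + 1)).
  rewrite meetsC; apply: (@meets_stable _ _ W _ (qev (d (r + 1)))).
  - exact: zW.
  - exact: qflag_triangular.
  - by move=> *; apply: flag_mono.
  exact: raises_z.
rewrite Z4_add11; apply: (@meets_stable _ _ W _ (fun i => (qev (d r) i)^-1)).
- exact: zW.
- exact: triangular_zV.
- by move=> *; apply: flag_mono.
by rewrite -Z4_add11.
Qed.

End Inverses.

(** * Flags in a module *)

Section Box.
Variables (V : vectType F) (d : nat) (z y : 'Z_4 -> 'End(V)).
Hypothesis zz : forall r v, z r (z (r + 2) v) = v.
Hypothesis zdiag : forall r, qdiag d (z r).
Hypothesis ydiag : forall r, qdiag d (y r).
Hypothesis weyl_zy : forall r, weyl (z (r + 2)) (y r).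
Hypothesis weyl_yz : forall r, weyl (y r) (z (r + 1)).
Local Notation H r := (qflag d (z r)).

Lemma qevVS i : (qev d i.+1)^-1 = q ^+ 2 * (qev d i)^-1.
Proof. by rewrite qevS invfM invrK. Qed.

Let qevV_inj : injective (fun i => (qev d i)^-1).
Proof. by move=> i j /invr_inj /qev_inj. Qed.

Lemma triangular_y_start r : triangular (y r) (qev d) (H r).
Proof.
apply: flag_triangular => i v vE; apply: qdiag_above => //.
rewrite -(eig_inv zz) ?mulf_neq0 ?expf_neq0 ?qev_neq0 //.
move: vE; rewrite -(eig_inv zz) ?qev_neq0 // => /eigP zv.
have nz : (qev d i)^-1 != 0 by rewrite invr_neq0 ?qev_neq0.
have /(weyl_at_eigl _ nz zv) := weyl_zy r v.
by rewrite invrK [(_ * qev d i)^-1]invfM.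
Qed.

Lemma triangular_y_end r : triangular (y r) (fun i => (qev d i)^-1) (H (r + 1)).
Proof.
apply: flag_triangular => i v /eigP zv; apply: qdiag_above => //.
by have /(weyl_at_eigr _ (qev_neq0 d i) zv) := weyl_yz r v.
Qed.

Lemma triangular_z_ystart r :
  triangular (z (r + 2)) (fun i => (qev d i)^-1) (qflag d (y r)).
Proof.
apply: flag_triangular => i v /eigP yv; apply: qdiag_above => //.
by have /(weyl_at_eigr _ (qev_neq0 d i) yv) := weyl_zy r v.
Qed.

Lemma triangular_z_yend r : triangular (z (r + 1)) (qev d) (qflagV d (y r)).
Proof.
apply: flag_triangular => i v /eigP yv; apply: qdiag_aboveV => //.
have nz : (qev d i)^-1 != 0 by rewrite invr_neq0 ?qev_neq0.
by have /(weyl_at_eigl _ nz yv) := weyl_yz r v; rewrite invrK.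
Qed.

Lemma qflagV_inv r i : qflagV d (z (r + 2)) i = H r i.
Proof. by apply: eq_bigr => j _; rewrite eig_inv ?qev_neq0. Qed.

(** y_r is triangular on the eigenflag of z_r, and z_(r+2) is triangular on the
    eigenflag of y_r with the inverse eigenvalues, so each flag contains the
    other. *)
Lemma qflag_y r i : qflag d (y r) i = H r i.
Proof.
apply/eqP; rewrite eqEsubv -[X in (_ <= X)%VS && _]qflagV_inv.
apply/andP; split.
  exact: triangular_flag_eig qevV_inj (flag0 _) (triangular_z_ystart (r := r)) i.
exact: triangular_flag_eig (@qev_inj d) (flag0 _) (triangular_y_start (r := r)) i.
Qed.

(** The same argument with y_r and z_(r+1): the eigenvalues of y_r now run from
    q^-d upwards. *)
Lemma qflagV_y r i : qflagV d (y r) i = H (r + 1) i.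
Proof.
apply/eqP; rewrite eqEsubv; apply/andP; split.
  exact: triangular_flag_eig (@qev_inj d) (flag0 _) (triangular_z_yend (r := r)) i.
exact: triangular_flag_eig qevV_inj (flag0 _) (triangular_y_end (r := r)) i.
Qed.

Lemma raises_z r : raises (z (r + 1)) (H r).
Proof.
have sh : raises (z (r + 1)) (qflag d (y r)).
  apply: flag_raises => i v /eigP yv; exists (qev d i)^-1; rewrite qevS.
  by have /(weyl_at_eigl _ (qev_neq0 d i) yv) := weyl_yz r v.
by move=> i v; rewrite -!qflag_y; apply: sh.
Qed.

Lemma raises_y1 r : raises (y (r + 1)) (H r).
Proof.
have sh : raises (y (r + 1)) (qflagV d (z (r + 2))).
  apply: flag_raises => i v /eigP zv; exists (qev d i); rewrite qevVS.
  have nz : (qev d i)^-1 != 0 by rewrite invr_neq0 ?qev_neq0.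
  have := weyl_yz (r + 1) v; rewrite Z4_add11.
  by move/(weyl_at_eigr _ nz zv); rewrite invrK.
by move=> i v; rewrite -!qflagV_inv; apply: sh.
Qed.

Lemma raises_y2 r : raises (y (r + 2)) (H r).
Proof.
apply: flag_raises => i v /eigP zv; exists (qev d i)^-1; rewrite qevS.
have := weyl_zy (r + 2) v; rewrite Z4_add22.
by move/(weyl_at_eigl _ (qev_neq0 d i) zv).
Qed.

Lemma zdisjoint r i j v : (i + j <= d.+1)%N ->
  v \in H r i -> v \in H (r + 1) j -> v = 0.
Proof.
apply: triangular_disjoint (flag0 _) (triangular_y_start (r := r))
  (triangular_y_end (r := r)) _ i j v.
move=> i j lij; rewrite eq_sym qevV_neq //; lia.
Qed.

Lemma stable_y_start r i v : v \in H r i -> y r v \in H r i.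
Proof. by move: i v; apply: triangular_stable (triangular_y_start (r := r)). Qed.

Lemma stable_y_end r i v : v \in H (r + 1) i -> y r v \in H (r + 1) i.
Proof. by move: i v; apply: triangular_stable (triangular_y_end (r := r)). Qed.

Lemma eig_y_flags r i v : (i <= d)%N -> v \in eig (y r) (qev d i) ->
  v \in H r i.+1 /\ v \in H (r + 1) (d - i).+1.
Proof.
move=> lei vE; split; first by rewrite -qflag_y; apply: mem_flag vE.
by rewrite -qflagV_y; apply: (mem_flag (ltnSn _)); rewrite (@qevV _ _ i) // subnK.
Qed.

(** Let v be an eigenvector of y_r for t = q^(d-2i), and put
    w = y_(r+1) v - v / t. Then w lies in H_r (i+2) and in H_(r+1) (d-i), and
    y_r - q^-2 t sends it into H_r (i+1) meet H_(r+1) (d-i) = 0. *)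
Lemma weyl_yy r : weyl (y r) (y (r + 1)).
Proof.
apply: (qdiag_ind (ydiag r)) => [|u v Eu Ev|i v lei vE].
- by rewrite /weyl_at !homE !scaler0 subr0.
- rewrite /weyl_at !homE !scalerDr -Eu -Ev; coords; ring.
have /eigP yv := vE; have [v0 v1] := eig_y_flags lei vE.
apply/(weyl_at_eigl _ (qev_neq0 d i) yv); rewrite -qevS.
set w := _ - _; apply/eigP/eqP; rewrite -subr_eq0; apply/eqP.
have w0 : w \in H r i.+2.
  apply: memvB; first exact: raises_y1.
  by rewrite memvZ // (subvP (flag_mono _ (leqnSn _))).
have w1 : w \in H (r + 1) (d - i).
  by rewrite /w (@qevV d i (d - i)) ?subnKC //; apply: triangular_y_start v1.
apply: (@zdisjoint r i.+1 (d - i)); first by lia.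
  exact: triangular_y_start.
by rewrite memvB ?memvZ ?stable_y_end.
Qed.

Definition serre_at (x x' : 'End(V)) v :=
  x (x (x (x' v))) - qint q 3 *: x (x (x' (x v)))
  + (qint q 3 *: x (x' (x (x v))) - x' (x (x (x v)))) = 0.

(** On an eigenvector v of y_r for t, the q-Serre expression is
    (y_r - q^2 t) (y_r - t) (y_r - q^-2 t) applied to w = y_(r+2) v, because
    [3]_q = q^2 + 1 + q^-2. As w lies in H_r (i+2) and in H_(r+1) (d-i+2), the
    last factor alone brings it down to H_r (i+1) and the other two bring it
    down to H_(r+1) (d-i), and these meet trivially. The factors commute, so
    each flag may be treated with the order that suits it. *)
Lemma serre_yy r v : serre_at (y r) (y (r + 2)) v.
Proof.
have q2 : q * q - 1 != 0 by rewrite subr_eq0 -expr2 q_not_root1.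
elim/(qdiag_ind (ydiag r)): v => [|u v Eu Ev|i v lei vE].
- by rewrite /serre_at !homE !scaler0 !subr0 addr0.
- by rewrite /serre_at -[RHS]addr0 -{1}Eu -Ev; coords; ring.
have /eigP yv := vE; have [v0 v1] := eig_y_flags lei vE.
set t := qev d i in yv; have t0 : t != 0 by apply: qev_neq0.
set w := y (r + 2) v.
have w0 : w \in H r i.+2 by apply: raises_y2.
have w1 : w \in H (r + 1) (d - i).+2 by rewrite /w -Z4_add11; apply: raises_y1.
pose A x := y r x - (q ^- 2 * t) *: x.
pose B x := y r x - t *: x.
pose C x := y r x - (q ^+ 2 * t) *: x.
have CB : A (C (B w)) = 0.
  apply: (@zdisjoint r i.+1 (d - i)); first by lia.
    have -> : A (C (B w)) = C (B (A w)) by rewrite /A /B /C; coords; ring.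
    have Aw : A w \in H r i.+1 by rewrite /A -qevS; apply: triangular_y_start.
    have Bw : B (A w) \in H r i.+1.
      by apply: (subvP (flag_mono _ (leqnSn i))); apply: triangular_y_start.
    by rewrite memvB ?memvZ ?stable_y_start.
  have tV : t = (qev d (d - i))^-1 by rewrite (@qevV _ _ i) // subnK.
  have Cw : C w \in H (r + 1) (d - i).+1.
    by rewrite /C tV -qevVS; apply: triangular_y_end.
  have Bw : B (C w) \in H (r + 1) (d - i) by rewrite /B tV; apply: triangular_y_end.
  have -> : A (C (B w)) = A (B (C w)) by rewrite /A /B /C; coords; ring.
  by rewrite memvB ?memvZ ?stable_y_end.
rewrite /serre_at -CB /A /B /C !homE !yv !homE !yv !homE yv !homE -/w /qint.
by coords; field; rewrite q_neq0 q2.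
Qed.

Lemma flag_last_component r n W : zstable z W -> (0 < n)%N ->
    (W <= H r n)%VS -> ~~ (W <= H r n.-1)%VS ->
  exists2 w, w != 0 & w \in W /\ w \in eig (z r) (qev d n.-1).
Proof.
case: n => // n zW _ /subvP le /subvPn[w wW wN].
have [u uE Ew] := mem_flagP (le _ wW).
have uW : forall i, (i < n.+1)%N -> u i \in W.
  apply: (@sum_eig_mem _ _ (z r) n.+1 (qev d)) => //.
  - by move=> i j _ _ /qev_inj.
  - exact: zW.
  by rewrite -Ew.
exists (u n); last by split; [apply: uW | apply: uE].
apply: contraNneq wN => un0; rewrite Ew big_ord_recr /= un0 addr0.
by apply: memv_suml => i _; apply: mem_flag (ltn_ord i) (uE _ _); rewrite ltnS ltnW.
Qed.

(** Take the least i with W <= H_r i. The eigencomponent of W at the last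
    eigenvalue that occurs in W is nonzero and lies in the opposite flag. *)
Lemma flag_threshold r W : zstable z W -> W != 0%VS ->
  exists i, [/\ (i <= d.+1)%N, (W <= H r i)%VS
    & exists2 w, w != 0 & w \in W /\ w \in H (r + 2) (d.+2 - i)].
Proof.
move=> zW W0; have ex : exists i, (W <= H r i)%VS.
  by exists d.+1; rewrite zdiag subvf.
case: (ex_minnP ex) => i Wi imin.
have i0 : (0 < i)%N.
  by case: i Wi {imin} => //; rewrite [H r 0]flag0 subv0 (negPf W0).
have led : (i <= d.+1)%N by apply: imin; rewrite zdiag subvf.
exists i; split=> //.
have nWi : ~~ (W <= H r i.-1)%VS by apply/negP => /imin; lia.
have [w w0 [wW wE]] := flag_last_component zW i0 Wi nWi.
exists w => //; split=> //.
move: wE; rewrite -(eig_inv zz) ?qev_neq0 // (@qevV _ _ (d.+1 - i)); last by lia.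
by apply: mem_flag; lia.
Qed.

(** Let i be the threshold of W in H_r and j the one in H_(r+3). A nonzero
    vector of W in H_r i meet H_(r+1) (d+2-j) gives j <= i, and one in
    H_(r+2) (d+2-i) meet H_(r+3) j gives i <= j, both by [zdisjoint]. With i = j
    the first vector shows that the stable sum for m = d + 2 is nonzero, hence
    equal to W; on each of its terms y_r is a scalar by triangularity. *)
Lemma y_stable_of_minimal W : W != 0%VS -> zstable z W ->
    (forall U, (U <= W)%VS -> zstable z U -> U = 0%VS \/ U = W) ->
  forall r v, v \in W -> y r v \in W.
Proof.
move=> W0 zW Wmin r.
have [i [lei Wi [w w0 [wW wE]]]] := flag_threshold r zW W0.
have [j [lej Wj [x x0 [xW]]]] := flag_threshold (r + 3) zW W0.
rewrite Z4_add32 => xE.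
have ij : i = j.
  have gt1 : ~ (i + (d.+2 - j) <= d.+1)%N.
    by move=> le; case/eqP: x0; apply: (zdisjoint le) (subvP Wi _ xW) xE.
  have gt2 : ~ ((d.+2 - i) + j <= d.+1)%N.
    move=> le; case/eqP: w0; apply: (zdisjoint le) wE _.
    by rewrite Z4_add21 (subvP Wj).
  by clear -gt1 gt2 lei lej; lia.
have: meets W (H r) (H (r + 1)) d.+2 = W.
  case: (Wmin (meets W (H r) (H (r + 1)) d.+2)) => [|||//].
  - by apply/subv_sumP => k _; apply: capvSl.
  - exact: (@meets_zstable _ _ zz (fun => d) raises_z).
  have xT : x \in meets W (H r) (H (r + 1)) d.+2.
    apply: (@mem_meets _ _ _ _ _ _ i (d.+2 - i)) => //; first by clear -lei; lia.
      exact: (subvP Wi).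
    by rewrite ij.
  by move=> T0; case/eqP: x0; apply/eqP; rewrite -memv0 -T0.
move=> TW v; rewrite -{1}TW; apply: meets_ind => {v}.
move=> [|k] l v kl vW v0 v1.
  by rewrite (mem_flag0 v0) linear0 mem0v.
case: l kl v1 => [|l] kl v1.
  by rewrite (mem_flag0 v1) linear0 mem0v.
have /eqP : y r v - qev d k *: v = 0.
  apply: (@zdisjoint r k l); [by clear -kl; lia | exact: triangular_y_start |].
  by rewrite -(@qevV d l k); [apply: triangular_y_end | clear -kl; lia].
by rewrite subr_eq0 => /eqP->; apply: memvZ.
Qed.

(** Otherwise two consecutive terms of the common flag of y_r and z_r would
    coincide. *)
Lemma eig_y_neq0 r i : eig (z r) (qev d i) != 0%VS -> eig (y r) (qev d i) != 0%VS.
Proof.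
apply: contra => /eqP y0; have : flag (fun i => eig (y r) (qev d i)) i.+1 = H r i.
  by rewrite flagS y0 addv0 -qflag_y.
rewrite -/(qflag d (y r)) qflag_y => HS; rewrite -subv0; apply/subvP => v vE.
have : v \in H r i by rewrite -HS; apply: mem_flag vE.
by move/(qflag_eig0 _ vE) => ->; rewrite ?mem0v // => j lt; apply/eqP => /qev_inj; lia.
Qed.

End Box.

(** * Reconstruction of the remaining generators *)

Section Balanced.
Variables (V : vectType F) (dd : 'Z_4 -> nat) (z : 'Z_4 -> 'End(V)).
Hypothesis zz : forall r v, z r (z (r + 2) v) = v.
Hypothesis zdiag : forall r, qdiag (dd r) (z r).
Hypothesis eig_z_neq0 : forall r i, (i <= dd r)%N -> eig (z r) (qev (dd r) i) != 0%VS.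
Hypothesis raises_z : forall r, raises (z (r + 1)) (qflag (dd r) (z r)).
Hypothesis zirr : forall U, zstable z U -> U = 0%VS \/ U = fullv.
Local Notation H r := (qflag (dd r) (z r)).

Lemma qflag_proper r n : (n <= dd r)%N -> H r n <> fullv.
Proof.
move=> len Hn; have /negP[] := eig_z_neq0 len.
rewrite -subv0; apply/subvP => v vE; have : v \in H r n by rewrite Hn memvf.
by move/(qflag_eig0 _ vE) => ->; rewrite ?mem0v // => j lt; apply/eqP => /qev_inj; lia.
Qed.

Lemma meets_trivial_or_full r m :
  meets fullv (H r) (H (r + 1)) m = 0%VS \/ meets fullv (H r) (H (r + 1)) m = fullv.
Proof. by apply: zirr; apply: meets_zstable => // s v _; apply: memvf. Qed.

(** For m = d_r + 2 the term i = d_r + 1 is H_(r+1) 1, an eigenspace of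
    z_(r+1). *)
Lemma meets_full r : meets fullv (H r) (H (r + 1)) (dd r).+2 = fullv.
Proof.
case: (meets_trivial_or_full r (dd r).+2) => // T0.
have /negP[] := eig_z_neq0 (leq0n (dd (r + 1))).
rewrite -subv0 -T0; apply/subvP => v vE.
apply: (@mem_meets _ _ _ _ _ _ (dd r).+1 1); rewrite ?addn1 ?memvf //.
  by rewrite zdiag memvf.
exact: mem_flag vE.
Qed.

(** If d_(r+1) > d_r, every term of the sum that fills V would lie in the proper
    subspace H_(r+1) d_(r+1). Hence d_r >= d_(r+1) for every r, and going once
    around Z/4 gives equality. *)
Lemma diameter_const r s : dd r = dd s.
Proof.
have le t : (dd (t + 1)%R <= dd t)%N.
  rewrite leqNgt; apply/negP => lt; apply: (@qflag_proper (t + 1) (dd (t + 1))) => //.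
  apply/eqP; rewrite eqEsubv subvf -{1}(meets_full t).
  apply: meets_sub => -[|i] j u iju _ ut us.
    by rewrite (mem_flag0 ut) mem0v.
  by apply: (subvP (flag_mono _ _)) us; lia.
have le4 t : dd t = dd (t + 1)%R.
  apply/eqP; rewrite eqn_leq le andbT.
  have := le (t + 1); have := le (t + 2); have := le (t + 3).
  rewrite Z4_add11 Z4_add21 (_ : t + 3 + 1 = t); first by lia.
  by rewrite -addrA [X in t + X](_ : _ = 0) ?addr0 //; apply: val_inj.
case: (Z4_cases r s) => ->; [by []|exact: le4|by rewrite -Z4_add11 -!le4|].
by rewrite -Z4_add21 -Z4_add11 -!le4.
Qed.
End Balanced.

Section Reconstruction.
Variables (V : vectType F) (d : nat) (z : 'Z_4 -> 'End(V)).
Hypothesis zz : forall r v, z r (z (r + 2) v) = v.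
Hypothesis zdiag : forall r, qdiag d (z r).
Hypothesis eig_z_neq0 : forall r i, (i <= d)%N -> eig (z r) (qev d i) != 0%VS.
Hypothesis raises_z : forall r, raises (z (r + 1)) (qflag d (z r)).
Hypothesis zirr : forall U, zstable z U -> U = 0%VS \/ U = fullv.
Local Notation H r := (qflag d (z r)).

(** For m = d + 1 the sum is contained in H_r d, so it cannot be V and must
    vanish. *)
Lemma split_disjoint r i j v : (i + j <= d.+1)%N ->
  v \in H r i -> v \in H (r + 1) j -> v = 0.
Proof.
move=> lij vi vj; apply/eqP; rewrite -memv0.
have vT : v \in meets fullv (H r) (H (r + 1)) d.+1.
  apply: (@mem_meets _ _ _ _ _ _ i (d.+1 - i)); rewrite ?memvf //; first by lia.
  by apply: (subvP (flag_mono _ _)) vj; lia.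
case: (@meets_trivial_or_full _ (fun => d) _ zz raises_z zirr r d.+1) => [<- //|Tf].
have [] := @qflag_proper _ (fun => d) _ eig_z_neq0 r d (leqnn d).
apply/eqP; rewrite eqEsubv subvf -{1}Tf.
apply: meets_sub => k [|l] u kl _ uk ul.
  by rewrite (mem_flag0 ul) mem0v.
by apply: (subvP (flag_mono _ _)) uk; lia.
Qed.

Definition split_part r i := (H r i.+1 :&: H (r + 1)%R (d.+1 - i))%VS.

Lemma split_full r : flag (split_part r) d.+1 = fullv.
Proof.
apply/eqP; rewrite eqEsubv subvf.
rewrite -{1}(@meets_full _ (fun => d) _ zz zdiag eig_z_neq0 raises_z zirr r).
apply: meets_sub => -[|i] [|j] u ij _ ui uj.
- by lia.
- by rewrite (mem_flag0 ui) mem0v.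
- by rewrite (mem_flag0 uj) mem0v.
apply: (@mem_flag _ _ _ i); first by lia.
by rewrite memv_cap ui (_ : d.+1 - i = j.+1)%N //; lia.
Qed.

Lemma split_op r : exists y : 'End(V), forall i v, (i <= d)%N ->
  v \in split_part r i -> y v = qev d i *: v.
Proof.
have [|y yE] := @exists_scaling_op _ _ (split_part r) (qev d) d.+1; last first.
  by exists y => i v lei; apply: yE.
move=> k lek; apply/eqP; rewrite -subv0; apply/subvP => v.
rewrite memv_cap => /andP[vF vU]; rewrite memv0; apply/eqP.
apply: (@split_disjoint r k (d.+1 - k)); first by lia.
  move: vF; apply: (subvP _ v); apply/subv_sumP => j _.
  by apply: subv_trans (capvSl _ _) (flag_mono _ _).
by move: vU; rewrite memv_cap => /andP[].
Qed.

(** y_r acts on H_r (i+1) meet H_(r+1) (d+1-i) by q^(d-2i). The operators z_(r+2)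
    and z_(r+1) move these pieces down and up by one index, modulo a scalar,
    which is what the converse half of the eigenvector criterion for Weyl
    pairs asks for. *)
Lemma reconstruction : exists y : 'Z_4 -> 'End(V),
  [/\ forall r, qdiag d (y r), forall r, weyl (z (r + 2)) (y r)
    & forall r, weyl (y r) (z (r + 1))].
Proof.
have [y yE] := boolp.choice split_op; exists y.
have eig_y r i v : (i <= d)%N -> v \in split_part r i -> v \in eig (y r) (qev d i).
  by move=> lei vU; apply/eigP/yE.
have ydiag r : qdiag d (y r).
  apply/eqP; rewrite eqEsubv subvf -{1}(split_full r).
  apply/subv_sumP => i _; apply/subvP => v vU.
  by apply: (mem_flag (ltn_ord i)); apply: eig_y vU; rewrite -ltnS.
have spl (P : V -> Prop) r : P 0 -> (forall u v, P u -> P v -> P (u + v)) ->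
  (forall i v, (i <= d)%N -> v \in split_part r i -> P v) -> forall v, P v.
  move=> P0 PD PU v; have: v \in flag (split_part r) d.+1 by rewrite split_full memvf.
  case/memv_sumP=> u uE ->; elim/big_ind: _ => // i _.
  by apply: (PU i); rewrite ?uE // -ltnS.
have weyl0 (x x' : 'End(V)) : weyl_at x x' 0 by rewrite /weyl_at !homE !scaler0 subr0.
have weylD (x x' : 'End(V)) u v : weyl_at x x' u -> weyl_at x x' v -> weyl_at x x' (u + v).
  by rewrite /weyl_at !homE !scalerDr => <- <-; coords; ring.
split=> // r.
  apply: (spl _ r (weyl0 _ _) (@weylD _ _)) => i v lei vU.
  have /eigP yv := eig_y _ _ _ lei vU.
  move: vU; rewrite memv_cap => /andP[v0 v1].
  apply/(weyl_at_eigr _ (qev_neq0 d i) yv); set w := _ - _.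
  have w0 : w \in H r i by apply: (triangular_zV (d := fun=> d) zz).
  have w1 : w \in H (r + 1) (d.+2 - i).
    rewrite /w; apply: memvB; last by rewrite memvZ ?(subvP (flag_mono _ _) _ v1) //; lia.
    by rewrite subSn ?(leqW lei) // -Z4_add11; apply: raises_z.
  clearbody w; case: i lei w0 w1 {v0 v1 yv} => [|i] lei w0 w1.
    by rewrite (mem_flag0 w0) mem0v.
  by rewrite qevSK; apply: eig_y; [apply: ltnW | rewrite memv_cap w0].
apply: (spl _ r (weyl0 _ _) (@weylD _ _)) => i v lei vU.
  have /eigP yv := eig_y _ _ _ lei vU.
move: vU; rewrite memv_cap => /andP[v0 v1].
apply/(weyl_at_eigl _ (qev_neq0 d i) yv); set w := _ - _.
have w1 : w \in H (r + 1) (d - i).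
  rewrite /w (@qevV d i (d - i)) ?subnKC //; apply: qflag_triangular.
  by rewrite -subSn.
have w0 : w \in H r i.+2.
  rewrite /w; apply: memvB; first exact: raises_z.
  by rewrite memvZ ?(subvP (flag_mono _ _) _ v0).
rewrite -qevS; move: lei; rewrite leq_eqVlt => /predU1P[Ei|lti].
  by rewrite Ei subnn in w1; rewrite (mem_flag0 w1) mem0v.
by apply: eig_y => //; rewrite memv_cap w0 subSS.
Qed.

End Reconstruction.
End Weyl.

(** * Semisimple operators *)

Section Diagonalizable.
Variables (F : fieldType) (V : vectType F) (f : 'End(V)).

Lemma directv_eig (c : nat -> F) n :
  injective c -> directv (\sum_(i < n) eig f (c i)).
Proof.
move=> c_inj; apply/directv_sum_independent => u uE u0 i _.
pose u' (j : nat) := oapp u 0 (insub j).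
have u'E (j : 'I_n) : u' j = u j by rewrite /u' valK.
apply/eqP; rewrite -memv0 -u'E; apply: (@sum_eig_mem _ _ f n c).
- by move=> j k _ _ /c_inj.
- by move=> j lt; rewrite -[j]/(val (Ordinal lt)) u'E uE.
- by move=> v; rewrite memv0 => /eqP->; rewrite linear0 mem0v.
- by rewrite (eq_bigr u) ?u0 ?mem0v.
exact: ltn_ord.
Qed.

(** A stable U is the sum of its intersections with the eigenspaces; complement
    each of these inside its eigenspace. *)
Lemma diag_semisimple (c : nat -> F) n : injective c ->
  flag (fun i => eig f (c i)) n = fullv -> semisimple f.
Proof.
move=> c_inj full U /subvP fU.
have {}fU v : v \in U -> f v \in U by move=> vU; apply/fU/memv_img.
pose X i := (U :&: eig f (c i))%VS; pose E' i := (eig f (c i) :\: X i)%VS.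
exists (flag E' n); split.
- apply/subvP => _ /memv_imgP[v vE ->].
  apply: flag_stable vE => i w lt wE; apply: (mem_flag lt).
  by have /eigP-> := subvP (diffvSl _ _) _ wE; apply: memvZ.
- apply/eqP; rewrite eqEsubv subvf -full; apply/subv_sumP => i _.
  rewrite -(addv_diff_cap (eig f (c i)) (X i)) subv_add; apply/andP; split.
    apply: subv_trans (addvSr _ _); apply/subvP => v; exact: mem_flag (ltn_ord i).
  by apply: subv_trans (addvSl _ _); apply: subv_trans (capvSr _ _) (capvSl _ _).
apply/eqP; rewrite -subv0; apply/subvP => v /memv_capP[vU /mem_flagP[u uE Ev]].
rewrite Ev memv_suml // => i _; have ui := uE i (ltn_ord i).
rewrite -(capv_diff (eig f (c i)) (X i)) !memv_cap ui (subvP (diffvSl _ _) _ ui) andbT.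
apply: (@sum_eig_mem _ _ f n c u) => //; first by move=> j k _ _ /c_inj.
  by move=> j lt; apply: (subvP (diffvSl _ _)) (uE j lt).
by rewrite -Ev.
Qed.

End Diagonalizable.

(** A root of the characteristic polynomial of the matrix of f on a basis of
    W. *)
Lemma eigenvector_exists (F : closedFieldType) (V : vectType F) (f : 'End(V))
    (W : {vspace V}) : W != 0%VS -> (f @: W <= W)%VS ->
  exists a, exists2 v, v != 0 & v \in W /\ v \in eig f a.
Proof.
rewrite -dimv_eq0 => W0 /subvP fW.
pose b := vbasis W; have bW i : b`_i \in W.
  case: (ltnP i (size b)) => [lt|/(nth_default 0)-> //]; last exact: mem0v.
  by apply: vbasis_mem; apply: mem_nth.
pose A := \matrix_(i, j < \dim W) coord b j (f b`_i).
have [a a_root] : exists a, root (char_poly A) a.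
  by apply/closed_rootP; rewrite size_char_poly eqSS.
move: a_root; rewrite -eigenvalue_root_char => /eigenvalueP[w wA w0].
exists a; exists (\sum_i w 0 i *: b`_i).
  have /freeP bfree := basis_free (vbasisP W).
  apply: contraNneq w0 => /(bfree (fun i => w 0 i)) wE.
  by apply/eqP/rowP => i; rewrite mxE.
split; first by apply: memv_suml => i _; rewrite memvZ.
apply/eigP; rewrite linear_sum scaler_sumr /=.
transitivity (\sum_i \sum_j (w 0 i * A i j) *: b`_j).
  apply: eq_bigr => i _; rewrite linearZ /=.
  rewrite {1}(coord_vbasis (fW _ (memv_img f (bW i)))) scaler_sumr.
  by apply: eq_bigr => j _; rewrite scalerA mxE.
rewrite exchange_big; apply: eq_bigr => j _ /=.
rewrite -scaler_suml scalerA; congr (_ *: _).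
by have /rowP/(_ j) := wA; rewrite !mxE.
Qed.

(** A stable complement of the sum of all eigenspaces contains no eigenvector,
    hence is zero. *)
Lemma semisimple_diag (F : closedFieldType) (V : vectType F) (f : 'End(V))
    (c : nat -> F) n : semisimple f ->
    (forall a, passmx.leigenvalue f a -> exists2 i, (i < n)%N & a = c i) ->
  flag (fun i => eig f (c i)) n = fullv.
Proof.
move=> ss ev; set U := flag _ n.
have fU : (f @: U <= U)%VS.
  apply/subvP => _ /memv_imgP[v vU ->]; apply: flag_stable vU => i w lt wE.
  by apply: (mem_flag lt); have /eigP-> := wE; apply: memvZ.
have [W [fW UW capUW]] := ss U fU.
have [W0|W0] := eqVneq W 0%VS; first by rewrite -UW W0 addv0.
have [a [v v0 [vW vE]]] := eigenvector_exists W0 fW.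
have [|i lt Ea] := ev a.
  by apply: contraNneq v0 => E0; rewrite -memv0 -E0.
case/eqP: v0; apply/eqP; rewrite -memv0 -capUW memv_cap vW andbT.
by apply: (mem_flag lt); rewrite -Ea.
Qed.

(** * The two conditions of a q-inverting pair as flag conditions *)

Section Adapted.
Variables (F : fieldType) (q : F).
Hypotheses (q_neq0 : q != 0) (q_not_root1 : forall n : nat, (0 < n)%N -> q ^+ n != 1).
Variables (V : vectType F) (d : nat) (f f' up down : 'End(V)).
Hypotheses (ff' : cancel f' f) (f'f : cancel f f').

(** The shape shared by the two halves of the definition of a q-inverting pair:
    f = K, up = Ks, down = Ks^-1 in the first one, and f = Ks, up = K^-1,
    down = K in the second one. *)
Definition adapted := exists U : 'I_d.+1 -> {vspace V},
  decomposition U /\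
  forall i : 'I_d.+1,
    [/\ ((f - q ^ (d%:Z - (2 * i)%:Z) *: \1) @: U i = 0)%VS,
        (up @: U i <= \sum_(j < d.+1 | (j <= i.+1)%N) U j)%VS
      & (down @: U i <= \sum_(j < d.+1 | (i <= j.+1)%N) U j)%VS].

Let qinj : injective (qev q d) := @qev_inj F q q_neq0 q_not_root1 d.
Let E i := eig f (qev q d i).
Let E' i := eig f' (qev q d i).

Let E'E i : (i <= d)%N -> E' (d - i) = E i.
Proof.
move=> lei; rewrite /E' -(@qevV _ _ q_neq0 _ i) ?subnKC //.
by rewrite (eig_inverse ff' f'f) ?qev_neq0.
Qed.

Let sub_flag (A : nat -> {vspace V}) (P : pred 'I_d.+1) n :
    (forall i : 'I_d.+1, P i -> exists2 k, (k < n)%N & E i = A k) ->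
  (\sum_(i | P i) E i <= flag A n)%VS.
Proof.
move=> PA; apply/subv_sumP => i /PA[k lt ->]; apply/subvP => v.
exact: mem_flag.
Qed.

Let flag_sub (A : nat -> {vspace V}) (P : pred 'I_d.+1) n :
    (forall k, (k < n)%N -> exists2 i : 'I_d.+1, P i & A k = E i) ->
  (flag A n <= \sum_(i | P i) E i)%VS.
Proof.
move=> AP; apply/subv_sumP => k _; have [i Pi ->] := AP k (ltn_ord k).
exact: (sumv_sup i).
Qed.

Let full_inverse : qdiag q d f -> qdiag q d f'.
Proof.
move=> fd; apply/eqP; rewrite eqEsubv subvf -{1}fd.
apply: (@sub_flag E' xpredT) => i _; exists (d - i)%N; first by lia.
by rewrite E'E // -ltnS.
Qed.

Let sum_low n : qdiag q d f ->
  (\sum_(j < d.+1 | (j < n)%N) E j)%VS = flag E n.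
Proof.
move=> fd; apply/eqP; rewrite eqEsubv; apply/andP; split.
  by apply: sub_flag => i lt; exists i.
case: (leqP n d.+1) => [le|lt].
  by apply: flag_sub => k lt; exists (Ordinal (leq_trans lt le)).
apply: subv_trans (subvf _) _; rewrite -{1}fd; apply: flag_sub => k lk.
by exists (Ordinal lk) => //=; apply: ltn_trans lt.
Qed.

Let sum_high i : qdiag q d f ->
  (\sum_(j < d.+1 | (i <= j.+1)%N) E j)%VS = flag E' (d.+2 - i).
Proof.
move=> fd; apply/eqP; rewrite eqEsubv; apply/andP; split.
  apply: sub_flag => j lt; exists (d - j)%N; last by rewrite E'E // -ltnS.
  by have := ltn_ord j; lia.
case: i => [|i].
  apply: subv_trans (subvf _) _; rewrite -{1}fd; apply: flag_sub => k lk.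
  by exists (Ordinal lk).
apply: flag_sub => k lk; have lt : (d - k < d.+1)%N by lia.
by exists (Ordinal lt) => /=; [lia | rewrite -E'E ?leq_subr ?subKn //; lia].
Qed.

Lemma qdiag_inverse : qdiag q d f -> (forall i, (i <= d)%N -> E i != 0%VS) ->
  qdiag q d f' /\ forall i, (i <= d)%N -> E' i != 0%VS.
Proof.
move=> fd fn0; split=> [|i lei]; first exact: full_inverse.
by rewrite -(subKn lei) E'E ?leq_subr ?fn0 ?leq_subr.
Qed.

(** The subspaces of the decomposition are forced to be the eigenspaces of f, so
    the first sum is a term of the eigenflag of f, and the second one a term
    of the eigenflag of its inverse f'. *)
Lemma adaptedP : adapted <->
  [/\ qdiag q d f, forall i, (i <= d)%N -> eig f (qev q d i) != 0%VS,
      raises up (qflag q d f) & raises down (qflag q d f')].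
Proof.
split=> [[U [[U0 _ Ufull] UC]]|[fd fn0 shu shd]].
  have UsubE i : (U i <= E i)%VS.
    by have [scal _ _] := UC i; rewrite lkerE scal.
  have fd : qdiag q d f.
    apply/eqP; rewrite eqEsubv subvf -Ufull; apply/subv_sumP => i _.
    by apply/subvP => v /(subvP (UsubE i)); apply: mem_flag.
  have EsubU (i : 'I_d.+1) : (E i <= U i)%VS.
    apply/subvP => v vE; have: v \in fullv by apply: memvf.
    rewrite -Ufull => /memv_sumP[u uU Ev].
    pose u' (j : nat) := oapp u 0 (insub j).
    have u'E (j : 'I_d.+1) : u' j = u j by rewrite /u' valK.
    have uE (j : 'I_d.+1) : u j \in E i.
      rewrite -u'E; apply: (@sum_eig_mem _ _ f d.+1 (qev q d)) => //.
      - by move=> k l _ _ /qinj; apply.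
      - move=> k lt; rewrite -[k]/(val (Ordinal lt)) u'E.
        exact: subvP (UsubE _) _ (uU _ _).
      - by move=> w wE; have /eigP-> := wE; apply: memvZ.
      by rewrite (eq_bigr u) // -Ev.
    rewrite Ev; apply: memv_suml => j _; have [->|ne] := eqVneq j i; first exact: uU.
    have /eigP fu := uE j; have /eigP := subvP (UsubE j) _ (uU j isT).
    rewrite fu => /eqP; rewrite -subr_eq0 -scalerBl scaler_eq0 subr_eq0.
    case/predU1P=> [/qinj ij|/eqP->]; last exact: mem0v.
    by case/eqP: ne; apply/val_inj; rewrite /= ij.
  have UE : U = (fun i : 'I_d.+1 => E i).
    by apply: boolp.funext => i; apply/eqP; rewrite eqEsubv UsubE EsubU.
  rewrite {}UE in U0 UC {Ufull UsubE EsubU}; split=> //.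
  - by move=> i lei; apply: (U0 (Ordinal (lei : (i < d.+1)%N))).
  - move=> i; apply: flag_stable => j v lt vE.
    have [led|gtd] := leqP j d; last first.
      rewrite (qdiag_eig0 fd _ vE) ?linear0 ?mem0v //.
      by move=> k lek; apply/eqP => /qinj; lia.
    have [_ /subvP upE _] := UC (Ordinal (led : (j < d.+1)%N)).
    have := upE _ (memv_img up vE); rewrite (eq_bigl (fun k : 'I_d.+1 => k < j.+2)%N) //.
    by rewrite sum_low //; apply/subvP/flag_mono.
  have fd' := full_inverse fd.
  move=> i; apply: flag_stable => j v lt vE.
  have [led|gtd] := leqP j d; last first.
    rewrite (qdiag_eig0 fd' _ vE) ?linear0 ?mem0v //.
    by move=> k lek; apply/eqP => /qinj; lia.
  have lt' : (d - j < d.+1)%N by lia.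
  have [_ _ /subvP downE] := UC (Ordinal lt').
  move: vE; rewrite -/(E' j) -(subKn led) E'E ?leq_subr // => vE.
  have := downE _ (memv_img down vE); rewrite sum_high //=.
  by apply/subvP/flag_mono; lia.
exists (fun i : 'I_d.+1 => E i); split; first split.
- by move=> i; apply: fn0; rewrite -ltnS.
- exact/directv_eig/qinj.
- exact: fd.
move=> i; split.
- by apply/eqP; rewrite -lkerE.
- apply/subvP => _ /memv_imgP[v vE ->].
  rewrite (eq_bigl (fun k : 'I_d.+1 => k < i.+2)%N) // sum_low //.
  by apply: shu; apply: mem_flag vE.
apply/subvP => _ /memv_imgP[v vE ->]; rewrite sum_high //.
have lei : (i <= d)%N by rewrite -ltnS.
rewrite (_ : d.+2 - i = (d - i).+2)%N; last by lia.
by apply: shd; apply: (@mem_flag _ _ E' (d - i)) => //; rewrite E'E.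
Qed.

End Adapted.

(** * Representations of the presented algebra *)

Section Evaluation.
Variables (F : fieldType) (X : Type) (V : vectType F) (rho : X -> 'End(V)).

Fixpoint evalt (t : term F X) : 'End(V) :=
  match t with
  | Gen x => rho x
  | Cst c => c *: \1%VF
  | Add s t => evalt s + evalt t
  | Mul s t => (evalt s \o evalt t)%VF
  end.

Lemma evalt_cong (rel : term F X -> term F X -> Prop) :
    (forall s t, rel s t -> evalt s = evalt t) ->
  forall s t, cong rel s t -> evalt s = evalt t.
Proof.
move=> er s t; elim=> {s t} //=.
- by move=> x y z _ -> _ ->.
- by move=> x x' y y' _ -> _ ->.
- by move=> x x' y y' _ -> _ ->.
- by move=> x y z; rewrite addrA.
- by move=> x y; rewrite addrC.
- by move=> x; rewrite scale0r add0r.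
- by move=> x; rewrite -comp_lfunZl comp_lfun1l scaleN1r addNr scale0r.
- by move=> x y z; rewrite comp_lfunA.
- by move=> x; rewrite scale1r comp_lfun1l.
- by move=> x; rewrite scale1r comp_lfun1r.
- by move=> x y z; rewrite comp_lfunDl.
- by move=> x y z; rewrite comp_lfunDr.
- by move=> a b; rewrite scalerDl.
- by move=> a b; rewrite -comp_lfunZl comp_lfun1l scalerA.
by move=> a x; rewrite -comp_lfunZl -comp_lfunZr comp_lfun1l comp_lfun1r.
Qed.

End Evaluation.

Section FromOperators.
Variables (F : fieldType) (q : F) (V : vectType F) (rho : box_index -> 'End(V)).
Hypothesis rho_rel : forall s t, box_rel q s t -> evalt rho s = evalt rho t.

Definition ops_act (a : boxq q) : 'End(V) := evalt rho (repr a).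

Lemma ops_act_of t : ops_act (pa_of (box_rel q) t) = evalt rho t.
Proof. exact: evalt_cong rho_rel _ _ (pa_reprK _ _). Qed.

Fact ops_act_linear : linear ops_act.
Proof.
move=> c a b; rewrite -[a]pa_ofK -[b]pa_ofK -pa_ofZ -pa_ofD !ops_act_of /=.
by rewrite -comp_lfunZl comp_lfun1l.
Qed.

HB.instance Definition _ := GRing.isLinear.Build F (boxq q) 'End(V) _ ops_act ops_act_linear.

Fact ops_act1 : ops_act 1 = \1%VF.
Proof. by rewrite [ops_act 1]ops_act_of /= scale1r. Qed.

Fact ops_actM (a b : boxq q) : ops_act (a * b) = (ops_act a \o ops_act b)%VF.
Proof. by rewrite -[a]pa_ofK -[b]pa_ofK -pa_ofM !ops_act_of. Qed.

Definition ops_mod : fdmod q := FdMod ops_act1 ops_actM.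

Lemma ops_modE g : act ops_mod (xgen q g) = rho g.
Proof. exact: ops_act_of. Qed.

End FromOperators.

Section Modules.
Variables (F : fieldType) (q : F).

Lemma act_of (M : fdmod q) t :
  act M (pa_of (box_rel q) t) = evalt (fun g => act M (xgen q g)) t.
Proof.
elim: t => [//|c|s IHs t IHt|s IHs t IHt] /=.
- rewrite -(act1 M) -linearZ; congr (act M _).
  by rewrite -[RHS]pa_ofZ; apply/pa_eqP/cong_sym/cong_mul1r.
- by rewrite -IHs -IHt -linearD; congr (act M _); apply: pa_ofD.
by rewrite -IHs -IHt -actM; congr (act M _); apply: pa_ofM.
Qed.

Lemma act_rel (M : fdmod q) s t : box_rel q s t ->
  evalt (fun g => act M (xgen q g)) s = evalt (fun g => act M (xgen q g)) t.
Proof.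
by move=> st; rewrite -!act_of; congr (act M _); apply/pa_eqP/cong_rel.
Qed.

Lemma act_stable (M : fdmod q) (U : {vspace M}) :
    (forall g v, v \in U -> act M (xgen q g) v \in U) ->
  forall a v, v \in U -> act M a v \in U.
Proof.
move=> gU a; rewrite -[a]pa_ofK act_of; elim: (repr a) => //=.
- by move=> c v vU; rewrite scale_lfunE id_lfunE memvZ.
- by move=> s IHs t IHt v vU; rewrite add_lfunE memvD ?IHs ?IHt.
by move=> s IHs t IHt v vU; rewrite comp_lfunE IHs ?IHt.
Qed.

Lemma act_intertwine (M N : fdmod q) (sigma : 'Hom(M, N)) :
    (forall g v, sigma (act M (xgen q g) v) = act N (xgen q g) (sigma v)) ->
  forall a v, sigma (act M a v) = act N a (sigma v).
Proof.
move=> sg a; rewrite -[a]pa_ofK !act_of; elim: (repr a) => //=.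
- by move=> c v; rewrite !scale_lfunE !id_lfunE linearZ.
- by move=> s IHs t IHt v; rewrite !add_lfunE linearD /= IHs IHt.
by move=> s IHs t IHt v; rewrite !comp_lfunE IHs IHt.
Qed.

Lemma adj_succ (r : 'Z_4) : adj r (r + 1).
Proof. by rewrite /adj addrAC subrr add0r eqxx. Qed.

Lemma adj_succ2 (r : 'Z_4) : adj r (r + 2).
Proof. by rewrite /adj [r + 2 - r]addrAC subrr add0r eqxx orbT. Qed.

Definition gen1 r : box_index := exist _ (r, r + 1) (adj_succ r).
Definition gen2 r : box_index := exist _ (r, r + 2) (adj_succ2 r).

Lemma gen1E r s (h : adj r s) : s - r = 1 -> exist _ (r, s) h = gen1 r.
Proof. by move=> sr; apply: val_inj; rewrite /= -sr subrKC. Qed.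

Lemma gen2E r s (h : adj r s) : s - r = 2 -> exist _ (r, s) h = gen2 r.
Proof. by move=> sr; apply: val_inj; rewrite /= -sr subrKC. Qed.

Lemma gen_cases (g : box_index) : (exists r, g = gen1 r) \/ (exists r, g = gen2 r).
Proof.
case: g => -[r s] /= h; have := h; rewrite {1}/adj.
by case/orP=> /eqP sr; [left | right]; exists r; [apply: gen1E | apply: gen2E].
Qed.

End Modules.

Section Relations.
Variables (F : fieldType) (q : F).
Hypotheses (q_neq0 : q != 0) (q_not_root1 : forall n : nat, (0 < n)%N -> q ^+ n != 1).
Variables (V : vectType F).

Let q2 : q - q^-1 != 0.
Proof.
apply: contraNneq (q_not_root1 (n := 2) isT) => /eqP.
by rewrite subr_eq0 => /eqP qV; rewrite expr2 {2}qV divff.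
Qed.

Lemma weyl_evalt (rho : box_index -> 'End(V)) (x y : box_term F) :
  evalt rho (Mul (Cst _ (q - q^-1)^-1)
      (tsub (Mul (Mul (Cst _ q) x) y) (Mul (Mul (Cst _ q^-1) y) x)))
    = evalt rho (Cst _ 1) <->
  weyl q (evalt rho x) (evalt rho y).
Proof.
rewrite /= -!comp_lfunZl !comp_lfun1l scale1r.
split=> [E v|W].
  have /lfunP/(_ v) := E.
  rewrite scale_lfunE add_lfunE !scale_lfunE !comp_lfunE id_lfunE scaleN1r => Ev.
  by rewrite /weyl_at -[X in _ = _ *: X]Ev scalerA divff // scale1r.
apply/lfunP => v; rewrite scale_lfunE add_lfunE !scale_lfunE !comp_lfunE id_lfunE.
by rewrite scaleN1r (W v : _ = _) scalerA mulVf // scale1r.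
Qed.

Lemma serre_evalt (rho : box_index -> 'End(V)) (x y : box_term F) :
  evalt rho (Add (tsub (Mul (tpow x 3) y)
        (Mul (Mul (Mul (Cst _ (qint q 3)) (tpow x 2)) y) x))
     (tsub (Mul (Mul (Mul (Cst _ (qint q 3)) x) y) (tpow x 2)) (Mul y (tpow x 3))))
    = evalt rho (Cst _ 0) <->
  forall v, serre_at q (evalt rho x) (evalt rho y) v.
Proof.
set w := Add _ _; set X := evalt rho x; set Y := evalt rho y.
have EE v : evalt rho w v = X (X (X (Y v))) - qint q 3 *: X (X (Y (X v)))
    + (qint q 3 *: X (Y (X (X v))) - Y (X (X (X v)))).
  rewrite /= !(add_lfunE, comp_lfunE, scale_lfunE, id_lfunE).
  by rewrite !scale1r !scaleN1r.
split=> [E v|S]; first by rewrite /serre_at -EE E /= scale0r zero_lfunE.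
by apply/lfunP => v; rewrite EE S /= scale0r zero_lfunE.
Qed.

End Relations.

(** * The defining relations in terms of operators *)

Section OperatorRelations.
Variables (F : fieldType) (q : F).
Hypotheses (q_neq0 : q != 0) (q_not_root1 : forall n : nat, (0 < n)%N -> q ^+ n != 1).
Variables (V : vectType F).

Section OfRelations.
Variable rho : box_index -> 'End(V).
Hypothesis rho_rel : forall s t, box_rel q s t -> evalt rho s = evalt rho t.

Lemma box_rel_zz r v : rho (gen2 r) (rho (gen2 (r + 2)) v) = v.
Proof.
have r2 : r - (r + 2) = 2 by apply: Z4_sub2.
have sr : adj (r + 2) r by rewrite /adj r2 orbT.
have := rho_rel (box_rel_inv q (adj_succ2 r) sr (Z4_addKl _ _)).
rewrite /= (gen2E sr r2) (gen2E (adj_succ2 r) (Z4_addKl _ _)) scale1r => /lfunP/(_ v).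
by rewrite comp_lfunE id_lfunE.
Qed.

Lemma box_rel_zy r : weyl q (rho (gen2 (r + 2))) (rho (gen1 r)).
Proof.
have r2 : r - (r + 2) = 2 by apply: Z4_sub2.
have sr : adj (r + 2) r by rewrite /adj r2 orbT.
have r1 : r + 1 - r = 1 by rewrite addrAC subrr add0r.
have mem : (r - (r + 2), r + 1 - r) \in [:: (1, 1); (1, 2); (2, 1)] by rewrite r2 r1.
have := rho_rel (box_rel_weyl q sr (adj_succ r) mem).
by move/(weyl_evalt q_neq0 q_not_root1); rewrite /= (gen2E sr r2) (gen1E (adj_succ r) r1).
Qed.

Lemma box_rel_yz r : weyl q (rho (gen1 r)) (rho (gen2 (r + 1))).
Proof.
have r1 : r + 1 - r = 1 by rewrite addrAC subrr add0r.
have r2 : r + 1 + 2 - (r + 1) = 2 by rewrite addrAC subrr add0r.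
have mem : (r + 1 - r, r + 1 + 2 - (r + 1)) \in [:: (1, 1); (1, 2); (2, 1)].
  by rewrite r1 r2.
have := rho_rel (box_rel_weyl q (adj_succ r) (adj_succ2 (r + 1)) mem).
by move/(weyl_evalt q_neq0 q_not_root1).
Qed.

End OfRelations.

Section ToRelations.
Variables (y z : 'Z_4 -> 'End(V)).
Hypothesis zz : forall r v, z r (z (r + 2) v) = v.
Hypothesis zy : forall r, weyl q (z (r + 2)) (y r).
Hypothesis yz : forall r, weyl q (y r) (z (r + 1)).
Hypothesis yy : forall r, weyl q (y r) (y (r + 1)).
Hypothesis serre : forall r v, serre_at q (y r) (y (r + 2)) v.

(** Every generator x_{rs} has s - r equal to 1 or 2. *)
Definition rho_of (g : box_index) : 'End(V) :=
  let: (r, s) := val g in if s - r == 1 then y r else z r.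

Lemma rho_of1 r : rho_of (gen1 r) = y r.
Proof. by rewrite /rho_of /= addrAC subrr add0r eqxx. Qed.

Lemma rho_of2 r : rho_of (gen2 r) = z r.
Proof. by rewrite /rho_of /= [r + 2 - r]addrAC subrr add0r. Qed.

Lemma rho_of_rel w w' : box_rel q w w' -> evalt rho_of w = evalt rho_of w'.
Proof.
have dE (r s a : 'Z_4) : s - r = a -> s = r + a by move=> <-; rewrite subrKC.
case=> {w w'} [r s rs sr rs2|r s t rs st|r s t u rs tu rs1 st1 tu1].
- have sE := dE _ _ _ rs2; have sr2 : r - s = 2.
    by rewrite sE; apply: Z4_sub2.
  rewrite /= (gen2E rs rs2) (gen2E sr sr2) !rho_of2 sE scale1r.
  by apply/lfunP => v; rewrite comp_lfunE id_lfunE zz.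
- rewrite !inE !xpair_eqE => cases; apply/(weyl_evalt q_neq0 q_not_root1) => /=.
  case/or3P: cases => /andP[/eqP e1 /eqP e2].
  + by rewrite (gen1E rs e1) (gen1E st e2) !rho_of1 (dE _ _ _ e1).
  + by rewrite (gen1E rs e1) (gen2E st e2) rho_of1 rho_of2 (dE _ _ _ e1).
  rewrite (gen2E rs e1) (gen1E st e2) rho_of1 rho_of2 (_ : r = s + 2) //.
  by rewrite (dE _ _ _ e1) Z4_add22.
apply/(serre_evalt q) => v /=.
rewrite (gen1E rs rs1) (gen1E tu tu1) !rho_of1 (dE _ _ _ st1) (dE _ _ _ rs1).
by rewrite Z4_add11.
Qed.

End ToRelations.

End OperatorRelations.

Lemma minimal_zstable (F : fieldType) (V : vectType F) (z : 'Z_4 -> 'End(V))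
    (U : {vspace V}) : U != 0%VS -> zstable z U ->
  exists W, [/\ W != 0%VS, (W <= U)%VS, zstable z W
    & forall X, (X <= W)%VS -> zstable z X -> X = 0%VS \/ X = W].
Proof.
move: {2}(\dim U).+1 (ltnSn (\dim U)) => n; elim: n U => // n IH U ltn U0 zU.
have [Umin|/boolp.existsNP[X]] :=
  boolp.pselect (forall X, (X <= U)%VS -> zstable z X -> X = 0%VS \/ X = U).
  by exists U.
move=> /boolp.not_implyP[XU /boolp.not_implyP[zX /boolp.not_orP[X0 XnU]]].
have [||//|W [W0 WX zW Wmin]] := IH X.
- rewrite -ltnS; apply: leq_trans ltn; rewrite ltnS ltn_neqAle dimvS // andbT.
  by apply: contra_notN XnU => /eqP E; apply/eqP; rewrite eqEdim XU E /=.
- exact/eqP.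
by exists W; split=> //; apply: subv_trans XU.
Qed.

Lemma inv_lfunE (F : fieldType) (V : vectType F) (f g : 'End(V)) :
  cancel g f -> cancel f g -> (f^-1)%VF = g.
Proof.
move=> fg gf; have ker0 : lker f == 0%VS by apply/lker0P/(can_inj gf).
by apply/lfunP => v; rewrite -{1}(fg v) lker0_lfunK.
Qed.

(** * Type 1 modules and q-inverting pairs *)

Section TypeOneModules.
Variables (F : closedFieldType) (q : F).
Hypotheses (q_neq0 : q != 0) (q_not_root1 : forall n : nat, (0 < n)%N -> q ^+ n != 1).

Section Module.
Variables (M : fdmod q) (irrM : irr_type1 M).
Definition zM r := act M (xgen q (gen2 r)).
Definition yM r := act M (xgen q (gen1 r)).

Let zz : forall r v, zM r (zM (r + 2) v) = v.
Proof. exact: box_rel_zz (@act_rel _ _ M). Qed.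
Let weyl_zy r : weyl q (zM (r + 2)) (yM r).
Proof. exact: (box_rel_zy q_neq0 q_not_root1 (@act_rel _ _ M)). Qed.
Let weyl_yz r : weyl q (yM r) (zM (r + 1)).
Proof. exact: (box_rel_yz q_neq0 q_not_root1 (@act_rel _ _ M)). Qed.

Lemma module_diag : exists d, [/\ forall r, qdiag q d (zM r), forall r, qdiag q d (yM r)
  & forall r i, (i <= d)%N -> eig (zM r) (qev q d i) != 0%VS].
Proof.
have [_ [d ty]] := irrM.
have gdiag g : qdiag q d (act M (xgen q g)).
  have [ss ev] := ty g; apply: semisimple_diag ss _ => a /ev[i lei].
  by rewrite mul1r => ->; exists i.
exists d; split=> [r|r|r i lei]; [exact: gdiag | exact: gdiag |].
have [_ ev] := ty (gen2 r).
by apply/ev; exists i; rewrite ?mul1r.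
Qed.

(** A minimal stable subspace inside U is a submodule. *)
Lemma module_zirr (U : {vspace M}) : zstable zM U -> U = 0%VS \/ U = fullv.
Proof.
move=> zU; have [->|U0] := eqVneq U 0%VS; [by left | right].
have [d [zd yd _]] := module_diag.
have [W [W0 WU zW Wmin]] := minimal_zstable U0 zU.
have yW := y_stable_of_minimal q_neq0 q_not_root1 zz zd yd weyl_zy weyl_yz W0 zW Wmin.
have [[_ irr] _] := irrM.
case: (irr W) => [a|W00|Wf]; [|by case/eqP: W0|].
  apply/subvP => _ /memv_imgP[v vW ->]; apply: act_stable vW => g w wW.
  by case: (gen_cases g) => -[r ->]; [exact: (yW r w wW) | exact: (zW r w wW)].
by apply/eqP; rewrite eqEsubv subvf -Wf.
Qed.

Lemma x02E : act M (x02 q) = zM 0.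
Proof.
rewrite /x02 /zM; congr (act M (xgen q _)).
by apply: val_inj; congr (_, _); apply: val_inj.
Qed.

Lemma x13E : act M (x13 q) = zM 1.
Proof.
rewrite /x13 /zM; congr (act M (xgen q _)).
by apply: val_inj; congr (_, _); apply: val_inj.
Qed.

Lemma module_q_inverting : q_inverting q (lpair_of M).
Proof.
have [d [zd yd zn0]] := module_diag.
have sh := raises_z q_neq0 q_not_root1 zz zd yd weyl_zy weyl_yz.
have cz (r s : 'Z_4) : r + 2 = s -> cancel (zM s) (zM r) by move=> <- v; apply: zz.
have cs (r s : 'Z_4) : r + 1 = s -> raises (zM s) (qflag q d (zM r)).
  by move=> <-; apply: sh.
have z20 : cancel (zM 2) (zM 0) by apply/cz/val_inj.
have z31 : cancel (zM 3) (zM 1) by apply/cz/val_inj.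
have z02 : cancel (zM 0) (zM 2) by apply/cz/val_inj.
have z13 : cancel (zM 1) (zM 3) by apply/cz/val_inj.
have zV0 := inv_lfunE z20 z02; have zV1 := inv_lfunE z31 z13.
rewrite /q_inverting /= x02E x13E zV0 zV1.
split.
- by have [[]] := irrM.
- by split; [exists (zM 2) | exists (zM 3)].
- exists d; apply: (adaptedP q_neq0 q_not_root1 d (zM 1) (zM 3) z20 z02).2.
  split=> //; [exact: zn0 | exact/cs/val_inj | exact/cs/val_inj].
- have [|U [UD UC]] := (adaptedP q_neq0 q_not_root1 d (zM 2) (zM 0) z31 z13).2.
    split=> //; [exact: zn0 | exact/cs/val_inj | exact/cs/val_inj].
  by exists d, U; split=> // i; have [] := UC i.
move=> W /subvP KW /subvP KsW; apply: module_zirr.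
apply: (zstable2 zz (r := 0)) => v vW; first exact/KW/memv_img.
by rewrite add0r; apply/KsW/memv_img.
Qed.

End Module.

Lemma qdiag_eigenvalues (V : vectType F) d (f : 'End(V)) : qdiag q d f ->
    (forall i, (i <= d)%N -> eig f (qev q d i) != 0%VS) ->
  forall a, passmx.leigenvalue f a <->
    exists2 i : nat, (i <= d)%N & a = 1 * q ^ (d%:Z - (2 * i)%:Z).
Proof.
move=> fd fn0 a; split=> [fa|[i lei ->]]; last by rewrite mul1r; apply: fn0.
apply: boolp.contrapT => nex; case/negP: fa.
rewrite -subv0; apply/subvP => v vE; rewrite memv0; apply/eqP.
apply: (qdiag_eig0 fd _ vE) => i lei; apply/eqP => Ea; apply: nex.
by exists i; rewrite ?mul1r.
Qed.

Lemma end_invertible (V : vectType F) (f : 'End(V)) : bijective f ->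
  cancel f^-1%VF f /\ cancel f f^-1%VF.
Proof.
move=> [g fg _]; have ker0 : lker f == 0%VS by apply/lker0P/(can_inj fg).
by split; [apply: lker0_lfunVK | apply: lker0_lfunK].
Qed.

(** The z_r are K, Ks and their inverses; the y_r come from [reconstruction] and
    define a module structure on the space of the pair. *)
Lemma pair_module (P : lpair F) : q_inverting q P ->
  exists2 M : fdmod q, irr_type1 M & lpair_iso (lpair_of M) P.
Proof.
case=> V0 [bijK bijKs] [d Kcond] [e [U [UD UC]]] irr.
pose K := opK P; pose Ks := opKs P.
have [KK' K'K] := end_invertible bijK; have [SS' S'S] := end_invertible bijKs.
have [Kd Kn0 Ksh Ksh'] := (adaptedP q_neq0 q_not_root1 d Ks (Ks^-1)%VF KK' K'K).1 Kcond.
have Scond : adapted q e Ks (K^-1)%VF K.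
  by exists U; split=> // i; have [] := UC i.
have [Sd Sn0 Ssh Ssh'] := (adaptedP q_neq0 q_not_root1 e (K^-1)%VF K SS' S'S).1 Scond.
have [Kd' Kn0'] := qdiag_inverse q_neq0 KK' K'K Kd Kn0.
have [Sd' Sn0'] := qdiag_inverse q_neq0 SS' S'S Sd Sn0.
pose z (r : 'Z_4) := nth K [:: K; Ks; (K^-1)%VF; (Ks^-1)%VF] r.
(* nothing yet relates the diameters d and e of K and Ks *)
pose dd (r : 'Z_4) := nth d [:: d; e; d; e] r.
have zz : forall r v, z r (z (r + 2) v) = v.
  by apply: Z4_ind => v; [apply: KK' | apply: SS' | apply: K'K | apply: S'S].
have zd : forall r, qdiag q (dd r) (z r) by apply: Z4_ind.
have zn0 : forall r i, (i <= dd r)%N -> eig (z r) (qev q (dd r) i) != 0%VS.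
  by apply: Z4_ind.
have zsh : forall r, raises (z (r + 1)) (qflag q (dd r) (z r)) by apply: Z4_ind.
have zirr W : zstable z W -> W = 0%VS \/ W = fullv.
  move=> zW; apply: irr; apply/subvP => _ /memv_imgP[v vW ->].
    exact: (zW 0).
  exact: (zW 1).
have ed : e = d by apply: (diameter_const q_neq0 q_not_root1 zz zd zn0 zsh zirr 1 0).
move: zd zn0 zsh; rewrite /dd ed => {}zd {}zn0 {}zsh.
have dE : forall r : 'Z_4, nth d [:: d; d; d; d] r = d by apply: Z4_ind.
have {}zd r : qdiag q d (z r) by rewrite -{1}(dE r).
have {}zn0 r i : (i <= d)%N -> eig (z r) (qev q d i) != 0%VS.
  by have := zn0 r i; rewrite dE.
have {}zsh r : raises (z (r + 1)) (qflag q d (z r)) by have := zsh r; rewrite dE.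
have [y [yd zy yz]] := reconstruction q_neq0 q_not_root1 zz zd zn0 zsh zirr.
have yy := weyl_yy q_neq0 q_not_root1 zz zd yd zy yz.
have yser := serre_yy q_neq0 q_not_root1 zz zd yd zy yz.
pose M := ops_mod (rho_of_rel q_neq0 q_not_root1 zz zy yz yy yser).
have M1 r : act M (xgen q (gen1 r)) = y r by rewrite ops_modE rho_of1.
have M2 r : act M (xgen q (gen2 r)) = z r by rewrite ops_modE rho_of2.
exists M; first split.
- split=> // W actW; apply: zirr => r v vW.
  by rewrite -M2; apply: (subvP (actW _)); apply: memv_img.
- exists d => g; have [gd gn0] : qdiag q d (act M (xgen q g)) /\
      forall i, (i <= d)%N -> eig (act M (xgen q g)) (qev q d i) != 0%VS.
    case: (gen_cases g) => -[r ->]; rewrite ?M1 ?M2; split=> // i lei.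
    + by apply: (eig_y_neq0 q_neq0 q_not_root1 zz zd yd zy); apply: zn0.
    exact: zn0.
  split; last exact: qdiag_eigenvalues.
  exact: diag_semisimple (@qev_inj _ _ q_neq0 q_not_root1 d) gd.
exists \1%VF; split.
- by exists id => v; rewrite id_lfunE.
- have x02K : act M (x02 q) = K by rewrite x02E /zM M2.
  by rewrite comp_lfun1l comp_lfun1r; apply: x02K.
have x13Ks : act M (x13 q) = Ks by rewrite x13E /zM M2.
by rewrite comp_lfun1l comp_lfun1r; apply: x13Ks.
Qed.

(** The defect D = s y_r - y_r s satisfies D z_(r+1) = q^-2 z_(r+1) D and
    D z_(r+2) = q^2 z_(r+2) D, because the right-hand sides of the two Weyl
    relations cancel. So its kernel is stable, hence 0 or everything. If it
    were 0, D would send an eigenvector of z_(r+1) for q^d to one for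
    q^(d+2). *)
Lemma intertwiner_extends (M N : fdmod q) (s : 'Hom(M, N)) : irr_type1 M ->
    bijective s ->
    (forall v, s (zM M 0 v) = zM N 0 (s v)) ->
    (forall v, s (zM M 1 v) = zM N 1 (s v)) ->
  forall a v, s (act M a v) = act N a (s v).
Proof.
move=> irrM bijs s0 s1.
have zzM := box_rel_zz (@act_rel _ _ M); have zzN := box_rel_zz (@act_rel _ _ N).
have sV r : (forall v, s (zM M r v) = zM N r (s v)) ->
    forall v, s (zM M (r + 2) v) = zM N (r + 2) (s v).
  move=> sr v; have E := sr (zM M (r + 2) v); rewrite /zM zzM in E.
  by rewrite E (zzV zzN).
have sz r v : s (zM M r v) = zM N r (s v).
  have [->|->|->|->] := Z4_cases 0 r; rewrite ?add0r //.
    by have := sV 0 s0 v; rewrite add0r.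
  by have := sV 1 s1 v; rewrite (_ : 1 + 2 = 3) //; apply: val_inj.
apply: act_intertwine => g.
case: (gen_cases g) => -[r ->] v; last exact: sz.
pose D := ((s \o yM M r) - (yM N r \o s))%VF.
have DE w : D w = s (yM M r w) - yM N r (s w).
  by rewrite add_lfunE opp_lfunE !comp_lfunE.
have Dy w : D (zM M (r + 1) w) = q ^- 2 *: zM N (r + 1) (D w).
  have EM := box_rel_yz q_neq0 q_not_root1 (@act_rel _ _ M) r w.
  have EN := box_rel_yz q_neq0 q_not_root1 (@act_rel _ _ N) r (s w).
  have {}EM := congr1 s EM.
  rewrite /weyl_at -/(zM M _) -/(zM N _) -/(yM M _) -/(yM N _) in EM EN.
  rewrite !homE sz in EM; rewrite !DE !homE sz.
  have -> : s (yM M r (zM M (r + 1) w)) =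
      q^-1 *: (q^-1 *: zM N (r + 1) (s (yM M r w)) + (q - q^-1) *: s w).
    by rewrite -EM; coords; field.
  have -> : yM N r (zM N (r + 1) (s w)) =
      q^-1 *: (q^-1 *: zM N (r + 1) (yM N r (s w)) + (q - q^-1) *: s w).
    by rewrite -EN; coords; field.
  by coords; field.
have Dz w : D (zM M (r + 2) w) = q ^+ 2 *: zM N (r + 2) (D w).
  have EM := box_rel_zy q_neq0 q_not_root1 (@act_rel _ _ M) r w.
  have EN := box_rel_zy q_neq0 q_not_root1 (@act_rel _ _ N) r (s w).
  have {}EM := congr1 s EM.
  rewrite /weyl_at -/(zM M _) -/(zM N _) -/(yM M _) -/(yM N _) in EM EN.
  rewrite !homE sz in EM; rewrite !DE !homE sz.
  have -> : s (yM M r (zM M (r + 2) w)) =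
      q *: (q *: zM N (r + 2) (s (yM M r w)) - (q - q^-1) *: s w).
    by rewrite -EM; coords; field.
  have -> : yM N r (zM N (r + 2) (s w)) =
      q *: (q *: zM N (r + 2) (yM N r (s w)) - (q - q^-1) *: s w).
    by rewrite -EN; coords; field.
  by coords; ring.
have kerD : zstable (zM M) (lker D).
  apply: (zstable2 zzM (r := r + 1)) => w; rewrite !memv_ker => /eqP Dw.
    by rewrite Dy Dw !homE scaler0.
  by rewrite Z4_add11 Dz Dw !homE scaler0.
(* if D vanishes, s intertwines y_r; otherwise D is injective *)
have [D0|Df] := module_zirr irrM kerD; last first.
  have: v \in lker D by rewrite Df memvf.
  by rewrite memv_ker DE subr_eq0 => /eqP.
have [d [zd _ zn0]] := module_diag irrM.
have /negP[] := zn0 (r + 1) 0%N (leq0n d).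
rewrite -subv0 -D0; apply/subvP => w /eigP zw; rewrite memv_ker; apply/eqP.
have [t st ts] := bijs; rewrite -(ts (D w)).
have -> : t (D w) = 0; last by rewrite linear0.
apply: (qdiag_eig0 (zd (r + 1)) (a := q ^+ 2 * qev q d 0)).
  by move=> i _; apply: qev_above_neq.
apply/eigP; apply: (can_inj st); rewrite sz !homE ts.
have Dzw := Dy w; rewrite zw homE in Dzw.
by rewrite -scalerA Dzw scalerA divff ?scale1r ?expf_neq0.
Qed.

Lemma lpair_iso_fdmod_iso (M N : fdmod q) : irr_type1 M ->
  lpair_iso (lpair_of M) (lpair_of N) -> fdmod_iso M N.
Proof.
move=> irrM [s [bijs E0 E1]]; exists s; split=> //.
apply: intertwiner_extends => // v.
  by have /lfunP/(_ v) := E0; rewrite !comp_lfunE /= !x02E.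
by have /lfunP/(_ v) := E1; rewrite !comp_lfunE /= !x13E.
Qed.

End TypeOneModules.

(** * Isomorphism classes *)

Section Isomorphisms.

Lemma bijective_lfun (F : fieldType) (V W : vectType F) (s : 'Hom(V, W)) :
  bijective s -> exists t : 'Hom(W, V), cancel s t /\ cancel t s.
Proof.
move=> bijs; have [t' st' t's] := bijs; exists (s^-1)%VF.
have ker0 : lker s == 0%VS by apply/lker0P/bij_inj.
have st := lker0_lfunK ker0; split=> // w; by rewrite -{1}(t's w) st t's.
Qed.

Lemma bijective_comp_lfun (F : fieldType) (U V W : vectType F)
    (t : 'Hom(V, W)) (s : 'Hom(U, V)) :
  bijective t -> bijective s -> bijective (t \o s)%VF.
Proof.
move=> [t' tt' t't] [s' ss' s's]; exists (s' \o t') => v /=.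
  by rewrite comp_lfunE tt' ss'.
by rewrite comp_lfunE s's t't.
Qed.

Variables (F : fieldType) (q : F).

Lemma lpair_iso_refl (P : lpair F) : lpair_iso P P.
Proof.
exists \1%VF; split; rewrite ?comp_lfun1l ?comp_lfun1r //.
by exists id => v; rewrite id_lfunE.
Qed.

Lemma lpair_iso_sym (P Q : lpair F) : lpair_iso P Q -> lpair_iso Q P.
Proof.
move=> [s [bijs s0 s1]]; have [t [st ts]] := bijective_lfun bijs.
exists t; split; first by exists s.
  apply/lfunP => v; apply: (can_inj st); rewrite !comp_lfunE ts.
  by have /lfunP/(_ (t v)) := s0; rewrite !comp_lfunE ts.
apply/lfunP => v; apply: (can_inj st); rewrite !comp_lfunE ts.
by have /lfunP/(_ (t v)) := s1; rewrite !comp_lfunE ts.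
Qed.

Lemma lpair_iso_trans (P Q R : lpair F) :
  lpair_iso P Q -> lpair_iso Q R -> lpair_iso P R.
Proof.
move=> [s [bijs s0 s1]] [t [bijt t0 t1]]; exists (t \o s)%VF; split.
- exact: bijective_comp_lfun.
- by rewrite -comp_lfunA s0 !comp_lfunA t0.
by rewrite -comp_lfunA s1 !comp_lfunA t1.
Qed.

Lemma fdmod_iso_refl (M : fdmod q) : fdmod_iso M M.
Proof.
exists \1%VF; split; last by move=> a v; rewrite !id_lfunE.
by exists id => v; rewrite id_lfunE.
Qed.

Lemma fdmod_iso_sym (M N : fdmod q) : fdmod_iso M N -> fdmod_iso N M.
Proof.
move=> [s [bijs sa]]; have [t [st ts]] := bijective_lfun bijs.
exists t; split; first by exists s.
by move=> a v; apply: (can_inj st); rewrite sa !ts.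
Qed.

Lemma fdmod_iso_trans (M N L : fdmod q) :
  fdmod_iso M N -> fdmod_iso N L -> fdmod_iso M L.
Proof.
move=> [s [bijs sa]] [t [bijt ta]]; exists (t \o s)%VF; split.
  exact: bijective_comp_lfun.
by move=> a v; rewrite !comp_lfunE /= sa ta.
Qed.

Lemma fdmod_iso_lpair (M N : fdmod q) :
  fdmod_iso M N -> lpair_iso (lpair_of M) (lpair_of N).
Proof.
move=> [s [bijs sa]]; exists s; split=> //; apply/lfunP => v;
  by rewrite !comp_lfunE /= sa.
Qed.

End Isomorphisms.

Lemma iso_class_eq (T : Type) (P : T -> Prop) (iso : T -> T -> Prop) x y :
  (forall x y, iso x y -> iso y x) ->
  (forall x y z, iso x y -> iso y z -> iso x z) ->
  iso x y -> iso_class P iso x = iso_class P iso y.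
Proof.
move=> sym trans xy; apply: boolp.funext => z; apply: boolp.propext.
split=> -[Pz iz]; split=> //; first exact: trans (sym _ _ xy) iz.
exact: trans xy iz.
Qed.

(** The map on classes sends C to the union of the classes of the f x, for x in
    C. *)
Lemma induces_bijectionI (S T : Type)
    (P : S -> Prop) (isoS : S -> S -> Prop)
    (Q : T -> Prop) (isoT : T -> T -> Prop) (f : S -> T) :
    (forall x y, isoS x y -> isoS y x) ->
    (forall x y z, isoS x y -> isoS y z -> isoS x z) ->
    (forall x, isoT x x) ->
    (forall x y, isoT x y -> isoT y x) ->
    (forall x y z, isoT x y -> isoT y z -> isoT x z) ->
    (forall x, isoS x x) ->
    (forall x, P x -> Q (f x)) ->
    (forall x y, isoS x y -> isoT (f x) (f y)) ->
    (forall x y, P x -> P y -> isoT (f x) (f y) -> isoS x y) ->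
    (forall t, Q t -> exists2 x, P x & isoT (f x) t) ->
  induces_bijection P isoS Q isoT f.
Proof.
move=> symS trS reflT symT trT reflS PQ isof fiso surj; split=> //.
pose Phi (C : S -> Prop) t := exists x, C x /\ iso_class Q isoT (f x) t.
have PhiE x : P x -> Phi (iso_class P isoS x) = iso_class Q isoT (f x).
  move=> Px; apply: boolp.funext => t; apply: boolp.propext; split=> [|ft].
    move=> [y [[Py xy]]]; rewrite (@iso_class_eq _ Q isoT (f x) (f y)) //.
    exact: isof.
  by exists x; split=> //; split.
exists Phi; split=> //; split.
- by move=> _ [x Px ->]; exists (f x); [apply: PQ | apply: PhiE].
- move=> _ _ [x Px ->] [y Py ->]; rewrite !PhiE // => E.
  apply: iso_class_eq => //; apply: fiso => //.
  have : iso_class Q isoT (f y) (f y) by split; [apply: PQ | apply: reflT].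
  by rewrite -E => -[].
move=> _ [t Qt ->]; have [x Px xt] := surj t Qt.
exists (iso_class P isoS x); first by exists x.
by rewrite PhiE //; apply: iso_class_eq.
Qed.

Theorem mainTheorem3 (F : closedFieldType) (q : F)
    (q_neq0 : q != 0) (q_not_root1 : forall n : nat, (0 < n)%N -> q ^+ n != 1) :
  induces_bijection
    (@irr_type1 F q) (@fdmod_iso F q)
    (@q_inverting F q) (@lpair_iso F)
    (@lpair_of F q).
Proof.
apply: induces_bijectionI.
- exact: fdmod_iso_sym.
- exact: fdmod_iso_trans.
- exact: lpair_iso_refl.
- exact: lpair_iso_sym.
- exact: lpair_iso_trans.
- exact: fdmod_iso_refl.
- exact: module_q_inverting.
- exact: fdmod_iso_lpair.
- by move=> M N irrM _; apply: lpair_iso_fdmod_iso.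
exact: pair_module.
Qed.
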